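(* Let $n\ge 1$ and let $R_1$ and $R_2$ be two reduced words (in the alphabet $\{1,\dots,n-1\}$) for elements of $S_n$. Then $\mathbb P_{R_1,q}(w)=\mathbb P_{R_2,q}(w)$ for all $w\in S_n$, as functions of $q$ (equivalently, for every prime power $q$; equivalently, as rational functions of $q$), if and only if $R_1$ and $R_2$ lie in the same commutation class.
   Context: $S_n$ is the symmetric group with simple transpositions $s_i=(i\ i+1)$, $1\le i\le n-1$, and Coxeter length $\ell$. A word is a sequence $R=i_1i_2\cdots i_L$ with $i_j\in\{1,\dots,n-1\}$; $L(R)=L$ is its length and $w(R)=s_{i_1}\cdots s_{i_L}$. $R$ is reduced if $\ell(w(R))=L$. A commutation move replaces a consecutive factor $ij$ by $ji$ when $|i-j|>1$; two words lie in the same commutation class if one is obtained from the other by a finite sequence of commutation moves. For a prime power $q$, let $G=\mathrm{GL}_n(\mathbb F_q)$, $B$ the invertible upper triangular matrices, $E_\bullet$ the standard flag $E_i=\langle e_1,\dots,e_i\rangle$, and $G/B$ the variety of complete flags in $\mathbb F_q^n$. For $w\in S_n$ let $E^w_\bullet$ be the flag with $E^w_i=\langle e_{w(1)},\dots,e_{w(i)}\rangle$ and $X_w^\circ=B\cdot E^w_\bullet$ the Schubert cell. The Bott--Samelson variety of $R=i_1\cdots i_L$ is the set of sequences of complete flags $(F^{(0)}_\bullet,\dots,F^{(L)}_\bullet)$ with $F^{(0)}_\bullet=E_\bullet$ and $F^{(r-1)}_k=F^{(r)}_k$ for all $k\ne i_r$, $1\le r\le L$; the map $\pi_R$ sends such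 a sequence to $F^{(L)}_\bullet$. Define $\mathbb P_{R,q}(w)=|\pi_R^{-1}(X_w^\circ)|/(q+1)^{L(R)}$ (points over $\mathbb F_q$). For each $w$ this is given by a rational function of $q$ (namely $\mathrm{wt}_R(w)/(1+q)^{L}$ for a polynomial weight), which is how it is regarded as a function of $q$. *)

(* Defs.v *)
From HB Require Import structures.
From Stdlib Require Import Relation_Operators.
From mathcomp Require Import all_boot all_order all_fingroup all_algebra.

Set Implicit Arguments.
Unset Strict Implicit.
Unset Printing Implicit Defensive.

Import GRing.Theory VectorInternalTheory.

(* The library provides only a choiceType structure on {vspace vT}; over a
   finite field subspaces are canonical (row-reduced) matrices, hence finite. *)
HB.instance Definition _ (F : finFieldType) (vT : vectType F) :=
  Choice_isCountable.Build {vspace vT} (pcan_pickleK (can_pcan vs2mxK)).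
HB.instance Definition _ (F : finFieldType) (vT : vectType F) :
  isFinite {vspace vT} := CanIsFinite (@vs2mxK F vT).

(* The letter i : 'I_n.-1 stands for the letter i + 1 of {1, .., n-1}; likewise
   the points 0, .., n-1 of 'I_n stand for 1, .., n. *)
Notation word n := (seq 'I_n.-1).

Lemma letter_proof n (i : 'I_n.-1) : i < n.
Proof. exact: leq_trans (ltn_ord i) (leq_pred n). Qed.

Lemma letterS_proof n (i : 'I_n.-1) : i.+1 < n.
Proof. by rewrite -ltn_predRL. Qed.

Definition simple_transp n (i : 'I_n.-1) : 'S_n :=
  tperm (Ordinal (letter_proof i)) (Ordinal (letterS_proof i)).

(* In 'S_n, (s * t) x = t (s x); hence the reversed product, so that
   word_perm [:: i1; ..; iL] x = s_i1 (.. (s_iL x)). *)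
Definition word_perm n (R : word n) : 'S_n :=
  foldr (fun i w => w * simple_transp i)%g 1%g R.

Lemma word_perm_cat n (R1 R2 : word n) :
  word_perm (R1 ++ R2) = (word_perm R2 * word_perm R1)%g.
Proof. by elim: R1 => [|i R1 IH] /=; rewrite ?mulg1 // IH mulgA. Qed.

Lemma word_tperm n d (a b : 'I_n) :
  b = a + d :> nat -> exists R : word n, word_perm R = tperm a b.
Proof.
elim: d b => [|d IH] b Eb.
  exists [::]; have -> : b = a by apply: ord_inj; rewrite Eb addn0.
  by rewrite /= tperm1.
have lt_ad : a + d < n.-1 by rewrite ltn_predRL -addnS -Eb.
pose k : 'I_n.-1 := Ordinal lt_ad.
have Ek : Ordinal (letterS_proof k) = b by apply: ord_inj; rewrite Eb /= addnS.
case: (posnP d) => [d0 | d_gt0].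
  exists [:: k]; rewrite /= mul1g /simple_transp Ek; congr (tperm _ b).
  by apply: ord_inj; rewrite /= d0 addn0.
have [R ER] := IH (Ordinal (letter_proof k)) (erefl _).
exists (k :: R ++ [:: k]); rewrite /= word_perm_cat /= mul1g ER.
have -> : (simple_transp k * tperm a (Ordinal (letter_proof k)) *
  simple_transp k = tperm a (Ordinal (letter_proof k)) ^ simple_transp k)%g.
  by rewrite /conjg tpermV mulgA.
rewrite tpermJ /simple_transp Ek tpermL tpermD //.
  by rewrite -val_eqE /= -[X in _ != X]addn0 eqn_add2l -lt0n.
by rewrite -val_eqE /= Eb -[X in _ != X]addn0 eqn_add2l.
Qed.

Lemma word_exists n (w : 'S_n) : exists R : word n, word_perm R = w.
Proof.
have [ts -> _] := prod_tpermP w.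
elim: ts => [|[a b] ts [R IH]]; first by exists [::]; rewrite big_nil.
have [Q EQ] : exists Q : word n, word_perm Q = tperm a b.
  case: (leqP a b) => [le_ab | /ltnW le_ba].
    by apply: (@word_tperm _ (b - a)); rewrite subnKC.
  by rewrite tpermC; apply: (@word_tperm _ (a - b)); rewrite subnKC.
by exists (R ++ Q); rewrite word_perm_cat IH EQ big_cons.
Qed.

Lemma word_size_exists n (w : 'S_n) :
  exists l, [exists R : l.-tuple 'I_n.-1, word_perm R == w].
Proof.
have [R ER] := word_exists w.
by exists (size R); apply/existsP; exists (in_tuple R); rewrite /= ER.
Qed.

Definition coxeter_length n (w : 'S_n) : nat := ex_minn (word_size_exists w).

Definition reduced n (R : word n) : Prop :=
  coxeter_length (word_perm R) = size R.

Definition commutation_move n (R R' : word n) : Prop :=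
  exists (A B : word n) (i j : 'I_n.-1),
    [/\ (1 < `|i%:Z - j%:Z|)%R, R = A ++ [:: i, j & B]
      & R' = A ++ [:: j, i & B]].

Definition same_commutation_class n : word n -> word n -> Prop :=
  clos_refl_trans (word n) (@commutation_move n).

Notation subspace_seq F n := {ffun 'I_n.+1 -> {vspace 'cV[F]_n}}.

Section Flags.

Variables (F : finFieldType) (n : nat).

Definition is_flag (f : subspace_seq F n) : bool :=
  [forall i : 'I_n.+1, \dim (f i) == i] &&
  [forall i : 'I_n.+1, forall j : 'I_n.+1, (i <= j) ==> (f i <= f j)%VS].

Definition basis_vec (i : 'I_n) : 'cV[F]_n := delta_mx i ord0.

Definition perm_flag (w : 'S_n) : subspace_seq F n :=
  [ffun i : 'I_n.+1 =>
    <<[seq basis_vec (w j) | j : 'I_n <- enum 'I_n & j < i]>>%VS].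

Definition std_flag : subspace_seq F n :=
  [ffun i : 'I_n.+1 =>
    <<[seq basis_vec j | j : 'I_n <- enum 'I_n & j < i]>>%VS].

Definition borel : {set 'M[F]_n} :=
  [set g : 'M[F]_n |
    (g \in unitmx) &&
    [forall i : 'I_n, forall j : 'I_n, (j < i) ==> (g i j == 0%R)]].

Definition flag_act (g : 'M[F]_n) (f : subspace_seq F n) : subspace_seq F n :=
  [ffun i => (linfun (mulmx g) @: f i)%VS].

Definition schubert_cell (w : 'S_n) : {set subspace_seq F n} :=
  [set flag_act g (perm_flag w) | g in borel].

(* Step r : 'I_(size R) goes from the flag number r to the flag number r + 1.
   The letter tnth (in_tuple R) r, being 0-based, allows a change only of the
   subspace of dimension (tnth (in_tuple R) r).+1. *)
Definition bott_samelson (R : word n) :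
    {set {ffun 'I_(size R).+1 -> subspace_seq F n}} :=
  [set Fs : {ffun 'I_(size R).+1 -> subspace_seq F n} |
    [&& [forall r, is_flag (Fs r)],
        Fs ord0 == std_flag
      & [forall r : 'I_(size R), forall k : 'I_n.+1,
          (k != (tnth (in_tuple R) r).+1 :> nat) ==>
          (Fs (widen_ord (leqnSn _) r) k == Fs (lift ord0 r) k)]]].

Definition bs_proj (R : word n)
    (Fs : {ffun 'I_(size R).+1 -> subspace_seq F n}) : subspace_seq F n :=
  Fs ord_max.

(* The number P_{R,q}(w), where q is the cardinality of F. *)
Definition bs_prob (R : word n) (w : 'S_n) : rat :=
  (#|[set Fs in bott_samelson R | bs_proj Fs \in schubert_cell w]|%:R
     / (#|F|%:R + 1) ^+ size R)%R.

End Flags.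

(* Main.v *)
Require Import Defs.
From HB Require Import structures.
From Stdlib Require Import Relation_Operators.
From mathcomp Require Import all_boot all_order all_fingroup all_algebra.
From mathcomp Require Import zify.

(* For a flag in the cell of x, of the q + 1 flags that differ from it at most
   in dimension i, q lie in the cell of upper x i and one in that of lower x i,
   where upper x i and lower x i are the longer and the shorter of x and x s_i.
   So the number of points over the cell of w is a polynomial in q. Its
   coefficient of q^L is 1 for w = w(R) and 0 otherwise; its coefficient of
   q^(L-1) counts the ways to write w as the Demazure product of R with one
   letter deleted.

   The deleted letter exchanges the labels a < c in adjacent positions of the
   prefix permutation u. Comparing the rank functions #{p < k : x p >= m} of
   w(R) and of the Demazure product D of the remaining letters, the set of
   (k, m) where they differ has a bounding box that determines (a, c), and it
   determines which labels between a and c are to the left of a in u. Hence the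
   D's determine, for all a < b < c with a, c inverted by w(R), whether b meets
   a before c does, and these data determine the commutation class. *)

Set Implicit Arguments.
Unset Strict Implicit.
Unset Printing Implicit Defensive.

Import GRing.Theory Num.Theory.

(** * Prefixes of words and commutation classes *)

Section Letters.

Variable n : nat.
Implicit Types (i : 'I_n.-1) (p : 'I_n).

Definition lo i : 'I_n := Ordinal (letter_proof i).
Definition hi i : 'I_n := Ordinal (letterS_proof i).

Lemma simple_transpE i p :
  (simple_transp i p : nat) =
    if (p : nat) == i then i.+1 else if (p : nat) == i.+1 then (i : nat) else p.
Proof.
rewrite /simple_transp; case: tpermP => [->|->|/eqP p1 /eqP p2] /=.
- by rewrite eqxx.
- by rewrite eqxx; case: eqP => // ->.
- by move: p1 p2; rewrite -!val_eqE /= => /negbTE-> /negbTE->.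
Qed.

Lemma simple_transp_cases i p :
  let t : nat := simple_transp i p in
  (p : nat) = i /\ t = i.+1 \/ (p : nat) = i.+1 /\ t = i \/
  (p : nat) <> i /\ (p : nat) <> i.+1 /\ t = p.
Proof. by rewrite /= simple_transpE; do ![case: eqP => ?]; tauto. Qed.

End Letters.

Ltac transp_lia := repeat match goal with
  |- context [nat_of_ord (fun_of_perm (simple_transp ?i) ?p)] =>
     move: (simple_transp_cases i p); cbv zeta;
     generalize (nat_of_ord (fun_of_perm (simple_transp i) p))
  end; rewrite /=; intros; lia.

Section Words.

Variable n : nat.
Implicit Types (x y u w : 'S_n) (R A B : word n) (i j k : 'I_n.-1) (a b c e p : 'I_n).

(** A permutation is read as an arrangement: [x p] is the label at position p. The letter i
    exchanges the labels at positions i and i + 1, so the prefixes of a word give successive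
    arrangements. *)
Definition sw i x : 'S_n := (simple_transp i * x)%g.
Definition run x R : 'S_n := (word_perm R * x)%g.

Lemma simple_transpK i : involutive (simple_transp i).
Proof. exact: tpermK. Qed.

Lemma simple_transp_lo i : simple_transp i (lo i) = hi i.
Proof. exact: tpermL. Qed.

Lemma simple_transp_hi i : simple_transp i (hi i) = lo i.
Proof. exact: tpermR. Qed.

Lemma swE i x p : sw i x p = x (simple_transp i p).
Proof. by rewrite permM. Qed.

Lemma sw_inv i x e : (sw i x)^-1%g e = simple_transp i (x^-1%g e).
Proof. by rewrite /sw invMg tpermV permM. Qed.

Lemma swK i : involutive (sw i).
Proof. by move=> x; rewrite /sw mulgA tperm2 mul1g. Qed.

Lemma run0 x : run x [::] = x.
Proof. exact: mul1g. Qed.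

Lemma run_cons x i R : run x (i :: R) = run (sw i x) R.
Proof. by rewrite /run /= mulgA. Qed.

Lemma run_cat x A B : run x (A ++ B) = run (run x A) B.
Proof. by rewrite /run word_perm_cat mulgA. Qed.

Lemma run_rcons x R i : run x (rcons R i) = sw i (run x R).
Proof. by rewrite -cats1 run_cat run_cons run0. Qed.

Definition left x a b := (x^-1%g a < x^-1%g b)%N.

Lemma left_chain x b a c : left x a b -> left x b c -> left x a c.
Proof. exact: ltn_trans. Qed.

Lemma left_irr x a : left x a a = false.
Proof. exact: ltnn. Qed.

Lemma leftN x a b : a != b -> left x b a = ~~ left x a b.
Proof.
move=> neq_ab; rewrite /left -leqNgt [RHS]leq_eqVlt.
by case: eqP => [/ord_inj/perm_inj E|//]; rewrite E eqxx in neq_ab.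
Qed.

Lemma ltn_ord_neq a b : (a < b)%N -> (a != b) * (b != a).
Proof. by move=> ltab; rewrite -!val_eqE neq_ltn eq_sym neq_ltn ltab. Qed.

Definition up x i := (x (lo i) < x (hi i))%N.

(** A letter by letter substitute for reducedness ([reduced_asc]), which splits along concatenation
    and allows any starting arrangement. *)
Fixpoint asc x R := if R is i :: R' then up x i && asc (sw i x) R' else true.

Lemma asc_cat x A B : asc x (A ++ B) = asc x A && asc (run x A) B.
Proof. by elim: A x => [|i A IH] x /=; rewrite ?run0 // IH run_cons andbA. Qed.

(** Only the two labels at positions i and i + 1 change their relative order. *)
Lemma left_sw_cross i x a b :
  left x a b -> left (sw i x) a b \/ (x (lo i) = a /\ x (hi i) = b).
Proof.
rewrite /left !sw_inv => lt_ab.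
have [Ea|lo_a] := eqVneq a (x (lo i)); last first.
  left; move: lo_a.
  have -> : (a == x (lo i)) = (x^-1%g a == i :> nat).
    by rewrite -[X in X == _](permKV x) (inj_eq perm_inj) -val_eqE.
  by move: lt_ab; transp_lia.
have [Eb|hi_b] := eqVneq b (x (hi i)); first by right.
left; move: hi_b lt_ab; rewrite Ea permK simple_transp_lo /=.
have -> : (b == x (hi i)) = (x^-1%g b == i.+1 :> nat).
  by rewrite -[X in X == _](permKV x) (inj_eq perm_inj) -val_eqE.
transp_lia.
Qed.

Lemma left_sw i x a b : (a < b)%N -> up x i -> left x b a -> left (sw i x) b a.
Proof.
move=> ltab upx /(left_sw_cross i)[//|[Eb Ea]].
by move: upx; rewrite /up Ea Eb; lia.
Qed.

Lemma left_run x R a b : (a < b)%N -> asc x R -> left x b a -> left (run x R) b a.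
Proof.
move=> ltab; elim: R x => [|i R IH] x /=; first by rewrite run0.
by case/andP=> upx ascR lba; rewrite run_cons; apply: IH => //; apply: left_sw.
Qed.

Lemma left_cross i x : left (sw i x) (x (hi i)) (x (lo i)).
Proof. by rewrite /left !sw_inv !permK simple_transp_lo simple_transp_hi /=. Qed.

Lemma left_lohi i x : left x (x (lo i)) (x (hi i)).
Proof. by rewrite /left !permK /=. Qed.

Lemma crossing x R a c : left x a c -> left (run x R) c a ->
  exists A j B, [/\ R = A ++ j :: B, run x A (lo j) = a & run x A (hi j) = c].
Proof.
elim: R x => [|i R IH] x lac.
  by rewrite run0 => lca; have := left_chain lac lca; rewrite left_irr.
rewrite run_cons => lca.
have [lac'|[Ea Ec]] := left_sw_cross i lac; last by exists [::], i, R; rewrite run0.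
have [A [j [B [-> Ea Ec]]]] := IH _ lac' lca.
by exists (i :: A), j, B; rewrite run_cons.
Qed.

(* The label order b, a, c occurs on the way from x to run x R: if a < b < c
   and c ends up left of a, then b is passed by a before c is. *)
Definition ori x R a b c := exists A B,
  [/\ R = A ++ B, left (run x A) b a & left (run x A) a c].

(** * Commutation moves and their invariants *)

Definition far i j := (i.+1 < j)%N || (j.+1 < i)%N.

Lemma commutation_moveP R R' : commutation_move R R' <->
  exists A B i j, [/\ far i j, R = A ++ [:: i, j & B] & R' = A ++ [:: j, i & B]].
Proof.
split=> -[A [B [i [j [Hij -> ->]]]]]; exists A, B, i, j; split=> //;
  move: Hij; rewrite /far; lia.
Qed.

Lemma far_sym i j : far i j = far j i.
Proof. by rewrite /far orbC. Qed.

Lemma far_fixl i j : far i j ->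
  simple_transp j (lo i) = lo i /\ simple_transp j (hi i) = hi i.
Proof.
by rewrite /far => fij; split; apply: val_inj; move: fij; rewrite /=; transp_lia.
Qed.

Lemma up_far i j x : far i j -> up (sw j x) i = up x i.
Proof. by move=> /far_fixl[E1 E2]; rewrite /up !swE E1 E2. Qed.

Lemma swC_far i j x : far i j -> sw i (sw j x) = sw j (sw i x).
Proof.
move=> fij; apply/permP=> p; rewrite !swE; congr (x _); apply: val_inj.
by move: fij; rewrite /far /=; transp_lia.
Qed.

Lemma commutation_sym R R' : commutation_move R R' -> commutation_move R' R.
Proof.
move=> /commutation_moveP[A [B [i [j [fij -> ->]]]]]; apply/commutation_moveP.
by exists A, B, j, i; rewrite far_sym.
Qed.

Lemma run_move x R R' : commutation_move R R' -> run x R = run x R'.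
Proof.
move=> /commutation_moveP[A [B [i [j [fij -> ->]]]]].
by rewrite !run_cat !run_cons (swC_far _ fij).
Qed.

Lemma asc_move x R R' : commutation_move R R' -> asc x R -> asc x R'.
Proof.
move=> /commutation_moveP[A [B [i [j [fij -> ->]]]]].
rewrite !asc_cat => /andP[-> /=]; have fji : far j i by rewrite far_sym.
by rewrite (up_far _ fij) (up_far _ fji) (swC_far _ fij) => /and3P[-> -> ->].
Qed.

Lemma left_swE i x a b :
  left (sw i x) a b = (simple_transp i (x^-1%g a) < simple_transp i (x^-1%g b))%N.
Proof. by rewrite /left !sw_inv. Qed.

Lemma prefix_cases (A B A' B' : word n) : A ++ B = A' ++ B' ->
  (exists C, A' = A ++ C /\ B = C ++ B') \/ (exists C, A = A' ++ C /\ B' = C ++ B).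
Proof.
elim: A A' => [|i A IH] [|j A'] /=.
- by move=> ->; left; exists [::].
- by move=> ->; left; exists (j :: A').
- by move=> <-; right; exists (i :: A).
- by case=> <- /IH[[C [-> ->]]|[C [-> ->]]]; [left|right]; exists C.
Qed.

Lemma ori_move x R R' a b c : commutation_move R R' -> ori x R a b c -> ori x R' a b c.
Proof.
move=> /commutation_moveP[A [B [i [j [fij -> ->]]]]] [A' [B' [E lba lac]]].
case: (prefix_cases E) => -[C [EA EB]]; last first.
  by exists A', (C ++ [:: j, i & B]); rewrite EA -catA.
rewrite {A' E}EA in lba lac.
case: C EB lba lac => [|i1 C] EB lba lac.
  by exists A, [:: j, i & B]; rewrite cats0 in lba lac.
case: C EB lba lac => [[Ei EB]|j1 C [Ei Ej ->]] lba lac; last first.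
  exists (A ++ [:: j, i & C]), B'.
  rewrite -catA /=; split=> //; move: lba lac; rewrite -{}Ei -{}Ej;
  by rewrite !run_cat !run_cons (swC_far _ fij).
move: lba lac; rewrite -{}Ei.
rewrite run_cat run_cons run0; set y := run x A => lba lac.
(* The witness lies between the two commuting letters. If neither the state before both nor the
   state after both works, then undoing i reverses one of the pairs (b, a), (a, c) and applying j
   reverses one. These pairs share a label, so the positions moved by i and j would overlap. *)
have [[H1 H2]|[H1 H2]] : (left y b a /\ left y a c) \/
    (left (sw i (sw j y)) b a /\ left (sw i (sw j y)) a c); last 1 first.
- exists (A ++ [:: j; i]), B; rewrite -catA /=; split=> //;
  by rewrite run_cat !run_cons run0.
- rewrite (swC_far y fij) -{1 2}[y](swK i); set z := sw i y.
  have pos k e f : left z e f ->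
      left (sw k z) e f \/ (z^-1%g e = k :> nat /\ z^-1%g f = k.+1 :> nat).
    by case/(left_sw_cross k) => [|[<- <-]]; [left | right; rewrite !permK].
  move: (pos i _ _ lba) (pos i _ _ lac) (pos j _ _ lba) (pos j _ _ lac) fij.
  rewrite /far => -[?|[? ?]] [?|[? ?]] [?|[? ?]] [?|[? ?]] F;
  first [by left | by right | exfalso; lia].
- by exists A, [:: j, i & B].
Qed.

Lemma same_class_cat A B i : all (far i) A ->
  same_commutation_class (A ++ i :: B) (i :: A ++ B).
Proof.
elim/last_ind: A B => [|A k IH] B; first by move=> _; apply: rt_refl.
rewrite all_rcons => /andP[fik /IH{}IH].
rewrite !cat_rcons; apply: rt_trans (IH (k :: B)).
apply: rt_step; apply/commutation_moveP; exists A, B, k, i.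
by rewrite far_sym.
Qed.

Lemma same_class_cons i R R' :
  same_commutation_class R R' -> same_commutation_class (i :: R) (i :: R').
Proof.
elim=> [S T|S|S T U _ H1 _ H2]; last exact: rt_trans H1 H2; last exact: rt_refl.
move=> /commutation_moveP[A [B [k [j [fij -> ->]]]]]; apply: rt_step.
by apply/commutation_moveP; exists (i :: A), B, k, j.
Qed.

Lemma same_class_sym R R' :
  same_commutation_class R R' -> same_commutation_class R' R.
Proof.
elim=> [S T /commutation_sym|S|S T U _ H1 _ H2]; first exact: rt_step.
- exact: rt_refl.
- exact: rt_trans H2 H1.
Qed.

Lemma same_class_inv x R R' : same_commutation_class R R' ->
  [/\ run x R = run x R', asc x R -> asc x R' &
      forall a b c, ori x R a b c -> ori x R' a b c].
Proof.
elim=> [S T H|S //|S T U _ [E1 A1 O1] _ [E2 A2 O2]].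
- split; [exact: run_move | exact: asc_move | move=> a b c; exact: ori_move].
- split; first by rewrite E1.
  + by move=> /A1/A2.
  + by move=> a b c /O1/O2.
Qed.

Lemma ori_cons x i R a b c : ori x (i :: R) a b c <->
  (left x b a /\ left x a c) \/ ori (sw i x) R a b c.
Proof.
split=> [[[|j A] [B [E H1 H2]]]|[[H1 H2]|[A [B [-> H1 H2]]]]].
- by left; rewrite run0 in H1 H2.
- by case: E H1 H2 => <- ->; rewrite run_cons => H1 H2; right; exists A, B.
- by exists [::], (i :: R); rewrite run0.
- by exists (i :: A), B; rewrite run_cons.
Qed.

(** The inversion made by a first letter could never be undone. *)
Lemma asc_id x R : asc x R -> run x R = x -> R = [::].
Proof.
case: R => // i R /= /andP[upx ascR]; rewrite run_cons => E.
have := left_run upx ascR (left_cross i x); rewrite E.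
by move/(left_chain (left_lohi i x)); rewrite left_irr.
Qed.

Lemma run_far i x A : all (far i) A ->
  run x A (lo i) = x (lo i) /\ run x A (hi i) = x (hi i).
Proof.
elim/last_ind: A => [|A k IH]; first by rewrite run0.
rewrite all_rcons => /andP[fik /IH[E1 E2]]; rewrite run_rcons !swE.
by have [-> ->] := far_fixl fik.
Qed.

(** Of the two prefixes one extends the other; the inversion present in the shorter one persists in
    the longer one and contradicts its label order. *)
Lemma prefix_excl x (A B A' B' : word n) a c e : asc x (A ++ B) -> A ++ B = A' ++ B' ->
  (a < c)%N -> (a < e)%N -> left (run x A) e a -> left (run x A) a c ->
  left (run x A') c a -> left (run x A') a e -> False.
Proof.
move=> ascR E ltac ltae H1 H2 H3 H4.
case: (prefix_cases E) => -[C [EA EB]].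
- move: ascR H4; rewrite EB EA run_cat !asc_cat => /and3P[_ ascC _] H4.
  by have := left_chain (left_run ltae ascC H1) H4; rewrite left_irr.
- move: ascR H2; rewrite EA run_cat !asc_cat -andbA => /and3P[_ ascC _] H2.
  by have := left_chain (left_run ltac ascC H3) H2; rewrite left_irr.
Qed.

Lemma first_near i A : ~~ all (far i) A ->
  exists A0 k A1, [/\ A = A0 ++ k :: A1, all (far i) A0 & ~~ far i k].
Proof.
elim: A => //= k A IH; case fik: (far i k) => /=.
  by move=> /IH[A0 [k' [A1 [-> f0 f1]]]]; exists (k :: A0), k', A1; rewrite /= fik.
by move=> _; exists [::], k, A; rewrite fik.
Qed.

Lemma left_between j x e : left x (x (lo j)) e -> e != x (hi j) -> left x (x (hi j)) e.
Proof.
rewrite /left !permK /= => lt1 ne; rewrite ltn_neqAle lt1 andbT.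
apply: contra ne => /eqP E.
by rewrite -[e](permKV x) (inj_eq perm_inj) -val_eqE /= -E.
Qed.

(** Induction on R1: its first letter i exchanges a and c, which R2 also exchanges, after a prefix
    A. If all letters of A are far from i, that letter of R2 moves to the front; otherwise the first
    letter of A near i yields a label order that one of the two words cannot have. *)
Lemma same_class_ori x R1 R2 : asc x R1 -> asc x R2 -> run x R1 = run x R2 ->
    (forall a b c, (a < b < c)%N -> left (run x R1) c a ->
      ori x R1 a b c <-> ori x R2 a b c) ->
  same_commutation_class R1 R2.
Proof.
elim: R1 x R2 => [|i R1 IH] x R2.
  by move=> _ asc2; rewrite run0 => /esym /(asc_id asc2)-> _; apply: rt_refl.
move=> /= /andP[upx asc1] asc2 E H.
set a := x (lo i); set c := x (hi i).
have ltac : (a < c)%N := upx.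
have invac : left (run x (i :: R1)) c a.
  by rewrite run_cons; apply: left_run asc1 (left_cross i x).
have invac2 : left (run x R2) c a by rewrite -E.
have [A [j [B [ER Ea Ec]]]] := crossing (left_lohi i x) invac2.
rewrite -/a -/c in Ea Ec.
have ascA : asc x A by move: asc2; rewrite ER asc_cat => /andP[].
have ascjB : asc (run x A) (j :: B) by move: asc2; rewrite ER asc_cat => /andP[].
have l_ac : left (run x A) a c by rewrite -Ea -Ec left_lohi.
have farA : all (far i) A.
  apply/negPn/negP => /first_near[A0 [k [A1 [EA f0 nfk]]]].
  have [Ea0 Ec0] := run_far x f0; rewrite -/a -/c in Ea0 Ec0.
  set x0 := run x A0 in Ea0 Ec0.
  move: (ascA); rewrite EA asc_cat -/x0 /= => /and3P[asc0 upk ascA1].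
  have ERA : run x A = run (sw k x0) A1 by rewrite EA run_cat run_cons.
  have [Ek|[Ek|Ek]] : k = i :> nat \/ (k = i.+1 :> nat \/ i = k.+1 :> nat).
    by move: nfk; rewrite /far; lia.
  - have {}Ek : k = i by apply: val_inj.
    rewrite Ek in ascA1 ERA; have := left_cross i x0; rewrite Ea0 Ec0.
    move/(left_run ltac ascA1); rewrite -ERA => l2.
    by have := left_chain l_ac l2; rewrite left_irr.
  (* Here k = i + 1 exchanges c with a larger e before c meets a, so R2 has the order e, a, c; but
     R1 has c, a, e right after its first letter. *)
  - set e := x0 (hi k).
    have lok : lo k = hi i by apply: val_inj; rewrite /= Ek.
    have ltce : (c < e)%N by move: upk; rewrite /up lok Ec0.
    have ltae : (a < e)%N by apply: ltn_trans ltce.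
    have l_ec : left (run x A) e c.
      by rewrite ERA; apply: left_run ascA1 _ => //; rewrite -[c]Ec0 -lok left_cross.
    have l_ea : left (run x A) e a.
      apply/negPn/negP; rewrite -leftN; last by rewrite (ltn_ord_neq ltae).
      rewrite -{1}Ea => /left_between; rewrite Ec (ltn_ord_neq ltce) => /(_ isT).
      by move=> /(left_chain l_ec); rewrite left_irr.
    have l_ce0 : left x c e.
      apply/negPn/negP; rewrite -leftN; last by rewrite (ltn_ord_neq ltce).
      move=> /(left_run ltce asc0); rewrite -/x0 -[c]Ec0 -lok => l2.
      by have := left_chain l2 (left_lohi k x0); rewrite left_irr.
    have : ori x R2 a c e.
      apply/H; first by rewrite ltac.
        by rewrite E ER run_cat; apply: left_run ascjB l_ea.
      exists [:: i], R1; rewrite run_cons run0; split=> //; first exact: left_cross.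
      have := l_ce0; rewrite left_swE /left /a /c !permK simple_transp_lo /=.
      by clear; transp_lia.
    case=> A' [B' [ER' o1 o2]]; rewrite ER in ER' asc2.
    exact: (prefix_excl asc2 ER' ltac ltae l_ea l_ac o1 o2).
  (* Here k = i - 1 exchanges a with a smaller e, so R2 has the order a, e, c. In R1, e starts to
     the left of a, and after the first letter c stays to the left of a. *)
  - set e := x0 (lo k).
    have hik : hi k = lo i by apply: val_inj; rewrite /= Ek.
    have ltea : (e < a)%N by move: upk; rewrite /up hik Ea0.
    have ltec : (e < c)%N by apply: ltn_trans ltac.
    have l_ae : left (run x A) a e.
      by rewrite ERA; apply: left_run ascA1 _ => //; rewrite -[a]Ea0 -hik left_cross.
    have l_ce : left (run x A) c e.
      by rewrite -Ec; apply: left_between; rewrite ?Ea ?Ec // (ltn_ord_neq ltec).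
    have l_ea0 : left x e a.
      apply/negPn/negP; rewrite -leftN; last by rewrite (ltn_ord_neq ltea).
      move=> /(left_run ltea asc0); rewrite -/x0 -[a]Ea0 -hik => l2.
      by have := left_chain (left_lohi k x0) l2; rewrite left_irr.
    have : ori x (i :: R1) e a c.
      apply/H; first by rewrite ltea.
        by rewrite E ER run_cat; apply: left_run ascjB l_ce.
      exists (A0 ++ [:: k]), (A1 ++ j :: B); rewrite ER EA -!catA; split=> //;
        rewrite run_cat run_cons run0 -/x0.
        by rewrite -[a]Ea0 -hik left_cross.
      rewrite left_swE /e -Ec0 !permK simple_transp_lo hik /=; clear -Ek; transp_lia.
    rewrite ori_cons => -[[o1 _]|[A' [B' [ER1 o1 o2]]]].
      by have := left_chain o1 l_ea0; rewrite left_irr.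
    move: asc1; rewrite ER1 asc_cat => /andP[asc1 _].
    have := left_run ltac asc1 (left_cross i x) => l2.
    by have := left_chain (left_chain o1 o2) l2; rewrite left_irr.
(* The letters of A leave a at position i, so the letter of R2 that exchanges a and c is i
   itself. *)
have [Ea' _] := run_far x farA.
have {Ea'} Eij : j = i.
  have := Ea; rewrite -[a]Ea' => /perm_inj /(congr1 val) /= Eij; exact: val_inj.
rewrite {j Ea Ec}Eij in ER ascjB.
have cls : same_commutation_class R2 (i :: A ++ B) by rewrite ER; apply: same_class_cat.
have [E2 asc2' ori2] := same_class_inv x cls.
have [_ _ ori2'] := same_class_inv x (same_class_sym cls).
apply: rt_trans (same_class_sym cls).
apply: same_class_cons; apply: (IH (sw i x)) => //.
- by case/andP: (asc2' asc2).
- by rewrite -!run_cons E E2.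
move=> a' b' c' lt' inv'.
(* If [imp] gives the empty prefix as witness, it still serves after the letter i: b' stays to the
   left of a', and a' has not passed c' because S1 shows a' to the left of c' later. *)
have aux S1 S2 : asc (sw i x) S1 -> (ori x (i :: S1) a' b' c' -> ori x (i :: S2) a' b' c') ->
    ori (sw i x) S1 a' b' c' -> ori (sw i x) S2 a' b' c'.
  move=> ascS imp o; have : ori x (i :: S1) a' b' c' by apply/ori_cons; right.
  move=> /imp /ori_cons[[o1 o2]|//].
  case lac: (left (sw i x) a' c'); last first.
    case: o => A' [B' [ES _ o3]].
    have ltac' : (a' < c')%N by case/andP: lt'; apply: ltn_trans.
    move/negbT: lac; rewrite -leftN ?(ltn_ord_neq ltac') // => lca.
    rewrite ES asc_cat in ascS; case/andP: ascS => ascS _.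
    by have := left_chain o3 (left_run ltac' ascS lca); rewrite left_irr.
  have lba : left (sw i x) b' a' by apply: left_sw => //; case/andP: lt'.
  by exists [::], S2; rewrite run0.
rewrite -run_cons in inv'.
have {}H := H a' b' c' lt' inv'.
split=> [|].
  by apply: (aux R1 (A ++ B)) => // /H /ori2.
apply: (aux (A ++ B) R1); first by case/andP: (asc2' asc2).
by move=> /ori2' /H.
Qed.

End Words.

(** * Demazure products and rank functions *)

Section Dem.

Variable n : nat.
Implicit Types (x y u w : 'S_n) (R A B : word n) (i j : 'I_n.-1) (a b c e p : 'I_n).

Definition upper x i := if up x i then sw i x else x.
Definition lower x i := if up x i then x else sw i x.
Definition dem x R := foldl upper x R.

Lemma dem_asc x R : asc x R -> dem x R = run x R.
Proof.
elim: R x => [|i R IH] x /=; first by rewrite run0.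
by case/andP=> upx /IH E; rewrite {1}/upper upx E run_cons.
Qed.

Definition rank x k m : nat := \sum_(p : 'I_n) ((p < k) && (m <= x p))%N.

Lemma rankS x p m : rank x p.+1 m = (rank x p m + (m <= x p))%N.
Proof.
rewrite /rank (bigD1 p) //= [in RHS](bigD1 p) //= ltnS leqnn ltnn add0n addnC.
congr (_ + _)%N; apply: eq_bigr => q; rewrite -val_eqE ltnS /= => /negbTE E.
by rewrite leq_eqVlt E.
Qed.

Lemma rank_sw i x k m : k != i.+1 :> nat -> rank (sw i x) k m = rank x k m.
Proof.
move=> ki; rewrite /rank (reindex_inj (@perm_inj _ (simple_transp i))) /=.
apply: eq_bigr => p _; rewrite swE simple_transpK; congr (nat_of_bool (_ && _)).
by move: ki; transp_lia.
Qed.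

(** The larger of the labels at positions i and i + 1 comes first, so the rank at i + 1 gains one if
    either label is at least m. The [minn] expresses this by the ranks at i and i + 2, which do not
    change. *)
Lemma rank_upper i x k m : rank (upper x i) k m =
  if k == i.+1 then minn (rank x i m).+1 (rank x i.+2 m) else rank x k m.
Proof.
case: eqP => [->|/eqP ki]; last by rewrite /upper; case: ifP => // _; rewrite rank_sw.
have -> : rank (upper x i) i.+1 m = (rank x i m + (m <= maxn (x (lo i)) (x (hi i))))%N.
  rewrite -[X in rank _ X]/((lo i : nat).+1) rankS /=; congr (_ + _)%N.
    by rewrite /upper; case: ifP => // _; rewrite rank_sw //= neq_ltn ltnSn.
  rewrite /upper /up; case: ifP => // H; rewrite ?swE ?simple_transp_lo;
    by congr (nat_of_bool _); move: H; lia.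
rewrite (rankS x (hi i)) (rankS x (lo i)) /=; lia.
Qed.

Lemma rank_one (k p : nat) : rank 1 k p = \sum_(q : 'I_n) ((q < k) && (p <= q))%N.
Proof. by apply: eq_bigr => q _; rewrite perm1. Qed.

Lemma run1_rcons B i : asc 1 (rcons B i) ->
  asc 1 B /\ word_perm (rcons B i) = upper (word_perm B) i.
Proof.
rewrite -cats1 asc_cat /= andbT /run mulg1 => /andP[ascB upB]; split=> //.
by rewrite /upper upB word_perm_cat /= mul1g.
Qed.

Lemma dem_rcons x B i : dem x (rcons B i) = upper (dem x B) i.
Proof. by rewrite /dem foldl_rcons. Qed.

(* With rank_dem_ge: the rank function of a Demazure product is the min-plus
   product of the rank functions. *)
Lemma rank_dem_le u B (p k m : nat) : asc 1 B ->
  (rank (dem u B) k m <= rank u p m + rank (word_perm B) k p)%N.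
Proof.
elim/last_ind: B k => [|B i IH] k ascB.
  by rewrite rank_one -big_split leq_sum // => q _ /=; lia.
have [{}ascB ->] := run1_rcons ascB.
rewrite dem_rcons !rank_upper; case: eqP => _; last exact: IH.
have := IH i ascB; have := IH i.+2 ascB; lia.
Qed.

Lemma rank_dem_ge u B k m : asc 1 B ->
  exists p : nat, (rank u p m + rank (word_perm B) k p <= rank (dem u B) k m)%N.
Proof.
elim/last_ind: B k => [|B i IH] k ascB.
  exists k; rewrite rank_one big1 ?addn0 // => q _; lia.
have [{}ascB ->] := run1_rcons ascB.
rewrite dem_rcons rank_upper; case: eqP => Ek; last first.
  have [p Hp] := IH k ascB; exists p; rewrite rank_upper; case: eqP => // E; lia.
case: (leqP (rank (dem u B) i m).+1 (rank (dem u B) i.+2 m)) => _.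
  have [p Hp] := IH i ascB; exists p; rewrite rank_upper Ek eqxx; lia.
have [p Hp] := IH i.+2 ascB; exists p; rewrite rank_upper Ek eqxx; lia.
Qed.

(** The exchange property, by induction from the last letter: it keeps the order of p and q unless
    it exchanges them, in which case it is the letter to omit. *)
Lemma deletion A (p q : 'I_n) : (p < q)%N -> (run 1 A q < run 1 A p)%N ->
  exists A', (size A' < size A)%N /\ word_perm A' = (tperm p q * word_perm A)%g.
Proof.
rewrite /run mulg1; elim/last_ind: A p q => [|A i IH] p q ltpq.
  by rewrite /= !perm1; lia.
have wE B : word_perm (rcons B i) = (simple_transp i * word_perm B)%g.
  by rewrite -cats1 word_perm_cat /= mul1g.
rewrite wE !permM => lt2.
have [[Ep Eq]|ne] : (p = lo i /\ q = hi i) \/ (simple_transp i p < simple_transp i q)%N.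
- have := left_sw_cross (x := 1%g) i (a := p) (b := q).
  rewrite /left !sw_inv !invg1 !perm1 => /(_ ltpq)[|[<- <-]]; first by right.
  by left.
- exists A; rewrite size_rcons; split=> //.
  by rewrite Ep Eq mulgA -[tperm _ _]/(simple_transp i) tperm2 mul1g.
have [A' [szA' EA']] := IH _ _ ne lt2.
exists (rcons A' i); rewrite !size_rcons ltnS; split=> //.
rewrite wE EA' mulgA.
have -> : tperm (simple_transp i p) (simple_transp i q) = (tperm p q ^ simple_transp i)%g.
  by rewrite tpermJ.
by rewrite conjgE !mulgA mulgV mul1g.
Qed.

Lemma coxeter_length_le R : (coxeter_length (word_perm R) <= size R)%N.
Proof.
rewrite /coxeter_length; case: ex_minnP => l _; apply.
by apply/existsP; exists (in_tuple R).
Qed.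

Lemma reduced_le R R' : reduced R -> word_perm R' = word_perm R -> (size R <= size R')%N.
Proof. by move=> <- <-; apply: coxeter_length_le. Qed.

Lemma asc_prefix x R :
  (forall A j B, R = A ++ j :: B -> up (run x A) j) -> asc x R.
Proof.
elim: R x => //= i R IH x H; apply/andP; split.
  by have := H [::] i R erefl; rewrite run0.
by apply: IH => A j B E; rewrite -run_cons; apply: (H (i :: A) j B); rewrite E.
Qed.

(** At a descent, the exchange property turns A followed by j into a word shorter than A. *)
Lemma reduced_asc R : reduced R -> asc 1 R.
Proof.
move=> redR; apply: asc_prefix => A j B ER; rewrite /up.
rewrite ltn_neqAle; case: eqP => [/ord_inj/perm_inj/(congr1 val)/=|_ /=]; first by lia.
rewrite leqNgt; apply/negP => lt2.
have [//|A' [szA' EA']] := deletion _ lt2.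
have := reduced_le (R' := A' ++ B) redR _.
rewrite ER !size_cat /= !word_perm_cat /= EA' mulgA => /(_ erefl); lia.
Qed.

Lemma reduced_catr A B : reduced (A ++ B) -> reduced B.
Proof.
move=> redAB; apply/eqP; rewrite eqn_leq coxeter_length_le /=.
rewrite /coxeter_length; case: ex_minnP => l /existsP[B' /eqP EB'] _.
have := reduced_le (R' := A ++ B') redAB _.
by rewrite !word_perm_cat EB' !size_cat leq_add2l size_tuple => /(_ erefl).
Qed.

(* The pairs (k, m) at which deleting the crossing of a and c, which meet in
   adjacent positions of u, decreases rank. *)
Definition drop_cond u w a c k m :=
  [/\ a < m <= c, w^-1%g c < k <= w^-1%g a
    & forall e, e != a -> e != c ->
        (left u e a -> m <= e -> w^-1%g e < k) /\
        (left u c e -> e < m -> k <= w^-1%g e)]%N.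

(** The rank of [dem u B] is a minimum over cuts p ([rank_dem_le], [rank_dem_ge]). Compared position
    by position with the rank of w, a cut can fall below only at the two positions exchanged by j
    and only for p = j + 1; a drop then needs equality at all other positions. *)
Lemma rank_deleted A j B k m : reduced (A ++ j :: B) ->
  let u := run 1 A in let w := run 1 (A ++ j :: B) in
  (rank (dem u B) k m < rank w k m)%N <-> drop_cond u w (u (lo j)) (u (hi j)) k m.
Proof.
move=> red u w; have asc1 := reduced_asc red.
have ascB : asc 1 B by apply: reduced_asc; apply: (@reduced_catr [:: j]); apply: reduced_catr red.
set a := u (lo j); set c := u (hi j).
have /andP[ltac ascBu] : up u j && asc (sw j u) B.
  by move: asc1; rewrite asc_cat => /andP[].
rewrite /up -/a -/c in ltac.
pose pi := (word_perm B)^-1%g.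
have Ew : w = (word_perm B * (simple_transp j * u))%g by rewrite /w run_cat run_cons.
have w_inv e : w^-1%g e = pi (simple_transp j (u^-1%g e)).
  by rewrite Ew invMg permM -/pi sw_inv.
have wc : w^-1%g c = pi (lo j) by rewrite w_inv permK simple_transp_hi.
have wa : w^-1%g a = pi (hi j) by rewrite w_inv permK simple_transp_lo.
have ltw : (w^-1%g c < w^-1%g a)%N.
  have := left_run ltac ascBu (left_cross j u).
  by rewrite -run_cons -run_cat -/(left w c a).
(* Both ranks become sums over the positions i in u; [pi i] is where the word B carries the label at
   position i. *)
have cutE (p : nat) : (rank u p m + rank (word_perm B) k p =
    \sum_(i : 'I_n) (((i < p) && (m <= u i)) + ((pi i < k) && (p <= i))))%N.
  rewrite big_split /=; congr (_ + _)%N.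
  rewrite /rank (reindex_inj (@perm_inj _ pi)) /=.
  by apply: eq_bigr => i _; rewrite permKV.
have rankE : rank w k m = (\sum_(i : 'I_n) ((pi i < k) && (m <= u (simple_transp j i))))%N.
  rewrite /rank (reindex_inj (@perm_inj _ pi)) /=.
  by apply: eq_bigr => i _; rewrite Ew !permM permKV.
have hilo : hi j != lo j by rewrite -val_eqE /=; lia.
have other (i : 'I_n) : (i != lo j) && (i != hi j) ->
    [/\ simple_transp j i = i, (i : nat) != j & (i : nat) != j.+1].
  case/andP; rewrite -!val_eqE /= => n1 n2; split=> //.
  by apply: val_inj; move: n1 n2; rewrite /=; transp_lia.
pose S (p : nat) := (\sum_(i : 'I_n | (i != lo j) && (i != hi j))
  (((i < p) && (m <= u i)) + ((pi i < k) && (p <= i))))%N.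
pose T := (\sum_(i : 'I_n | (i != lo j) && (i != hi j)) ((pi i < k) && (m <= u i)))%N.
have {}cutE (p : nat) : (rank u p m + rank (word_perm B) k p =
   ((j < p) && (m <= a)) + ((pi (lo j) < k) && (p <= j)) +
   (((j.+1 < p) && (m <= c)) + ((pi (hi j) < k) && (p <= j.+1))) + S p)%N.
  by rewrite cutE (bigD1 (lo j)) //= (bigD1 (hi j)) //= addnA.
have {}rankE : (rank w k m =
    ((pi (lo j) < k) && (m <= c)) + ((pi (hi j) < k) && (m <= a)) + T)%N.
  rewrite rankE (bigD1 (lo j)) //= (bigD1 (hi j)) //= addnA simple_transp_lo simple_transp_hi.
  by congr (_ + _)%N; apply: eq_bigr => i /other[->].
(* Away from the exchanged positions, a position that counts for w counts for the cut, on whichever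
   side of p it lies. *)
have leTS (p : nat) : (T <= S p)%N by apply: leq_sum => i _; move: (pi i) => pi_i; clear; lia.
(* Equality of the sums forces equality term by term, which is the last clause of [drop_cond]. *)
have eqST : (S j.+1 <= T)%N -> forall i : 'I_n, (i != lo j) && (i != hi j) ->
    (i < j -> m <= u i -> pi i < k)%N /\ (j < i -> u i < m -> k <= pi i)%N.
  pose C (i : 'I_n) := (((pi i < k) && (m <= u i)) ==
    ((i < j.+1) && (m <= u i)) + ((pi i < k) && (j.+1 <= i)) :> nat)%N.
  have : (T <= S j.+1 ?= iff [forall (i : 'I_n | (i != lo j) && (i != hi j)), C i])%N.
    by apply: leqif_sum => i _; apply/leqifP; rewrite /C; move: (pi i) => pi_i; clear; case: eqP => H; lia.
  case=> leT E le2; have {}E : [forall (i : 'I_n | (i != lo j) && (i != hi j)), C i].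
    by rewrite -E eqn_leq leT.
  move=> i Hi; have := forall_inP E i Hi; rewrite /C; have [_ n1 n2] := other i Hi; lia.
split.
  move=> ltD; have [p] := rank_dem_ge u k m ascB.
  rewrite cutE => le1; have leT := leTS p; rewrite rankE in ltD.
  have Ep : p = j.+1 by move: le1 ltD leT ltw; rewrite wc wa; lia.
  rewrite {p}Ep in le1 leT.
  have H1 : (a < m <= c)%N by move: le1 ltD leT ltw ltac; rewrite wc wa; lia.
  have H2 : (w^-1%g c < k <= w^-1%g a)%N.
    by move: le1 ltD leT ltw ltac; rewrite wc wa; lia.
  have leS : (S j.+1 <= T)%N.
    by move: le1 ltD leT ltw ltac H1 H2; rewrite wc wa; clear; lia.
  split=> // e ea ec.
  have ue : u (u^-1%g e) = e by rewrite permKV.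
  have Hi : (u^-1%g e != lo j) && (u^-1%g e != hi j).
    by rewrite -(inj_eq (@perm_inj _ u) _ (lo j)) -(inj_eq (@perm_inj _ u) _ (hi j)) ue ea.
  have [h1 h2] := eqST leS (u^-1%g e) Hi.
  rewrite w_inv; have [-> _ _] := other _ Hi.
  rewrite /left /a /c !permK /=; rewrite ue in h1 h2.
  by split=> [l1 | l1]; [apply: h1 | apply: h2; apply: ltnW].
case=> H1 H2 H3; apply: leq_ltn_trans (rank_dem_le u j.+1 k m ascB) _.
rewrite cutE rankE.
suff : (S j.+1 <= T)%N by move: H1 H2; rewrite wc wa; clear; lia.
apply: leq_sum => i Hi; have [E n1 n2] := other i Hi.
have [|| h1 h2] := H3 (u i).
- by rewrite (inj_eq perm_inj); case/andP: Hi.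
- by rewrite (inj_eq perm_inj); case/andP: Hi.
move: h1 h2; rewrite w_inv permK E /left /a /c !permK /=.
move: n1 n2; clear; lia.
Qed.

End Dem.

(** * Recovering the commutation class from the deletions *)

Section Ori.

Variable n : nat.
Implicit Types (x y u w D : 'S_n) (R A B : word n) (i j : 'I_n.-1) (a b c e f p : 'I_n).

(** What the comparison of deletions uses of an ascending word to w that exchanges a and c after a
    prefix u; the clause on e alone says that a and c are adjacent in u. *)
Definition crosses u w a c :=
  [/\ (a < c)%N, left u a c, left w c a,
      forall e, e != c -> left u a e -> left u c e
    & forall e f, (e < f)%N -> left u f e -> left w f e].

Lemma crossesP A j B : asc 1 (A ++ j :: B) ->
  crosses (run 1 A) (run 1 (A ++ j :: B)) (run 1 A (lo j)) (run 1 A (hi j)).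
Proof.
rewrite asc_cat => /andP[_ ascB]; move: (ascB) => /= /andP[upj ascB'].
split=> // [||e ec /left_between|e f ltef].
- exact: left_lohi.
- by rewrite run_cat run_cons; apply: (left_run (upj : (_ < _)%N) ascB'); apply: left_cross.
- by apply.
- by rewrite run_cat; apply: left_run.
Qed.

(** With [drop_corner_a]: two opposite corners of the box of drops, attaining m = c and m = a + 1.
    Hence the set of drops determines a and c. *)
Lemma drop_corner_c u w a c : crosses u w a c -> drop_cond u w a c (w^-1%g c).+1 c.
Proof.
case=> ltac lac lca adj keep; split; rewrite ?ltac ?leqnn //=.
move=> e ea ec; split=> [lea le_ce | lce lt_ec]; last exact: keep.
rewrite ltnS ltnW //; apply: keep; last exact: left_chain lea lac.
by rewrite ltn_neqAle le_ce andbT eq_sym val_eqE.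
Qed.

Lemma drop_corner_a u w a c : crosses u w a c -> drop_cond u w a c (w^-1%g a) a.+1.
Proof.
case=> ltac lac lca adj keep; split; rewrite ?ltac ?leqnn ?andbT ?ltnSn //=.
move=> e ea ec; split=> [lea lt_ae | lce le_ea]; first exact: keep.
apply: ltnW; apply: keep; last exact: left_chain lac lce.
by rewrite ltn_neqAle -ltnS le_ea andbT val_eqE.
Qed.

Lemma drop_pair u u' w a c a' c' : crosses u w a c ->
    (forall k m, drop_cond u w a c k m -> drop_cond u' w a' c' k m) ->
  (a' <= a)%N /\ (c <= c')%N.
Proof.
move=> cr H; have [/andP[_ ->] _ _] := H _ _ (drop_corner_c cr).
by have [/andP[+ _] _ _] := H _ _ (drop_corner_a cr); rewrite ltnS.
Qed.

(* A label b that is maximal, for label and final position, among those to the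
   left of a in u' but not in u yields a pair that drops for u' only. *)
Lemma drop_left u u' w a c : crosses u w a c -> crosses u' w a c ->
    (forall k m, drop_cond u' w a c k m -> drop_cond u w a c k m) ->
  forall b, (a < b < c)%N -> left u' b a -> left u b a.
Proof.
move=> [ltac lac lca adj keep] [_ lac' _ adj' keep'] H b0 ltb0 lb0.
apply/negPn/negP => nlb0.
pose P b := [&& (a < b < c)%N, left u' b a & ~~ left u b a].
have Pb0 : P b0 by rewrite /P ltb0 lb0 nlb0.
(* Maximising the sum of label and final position gives a label that no other one exceeds in
   both. *)
case: (@arg_maxnP _ b0 P (fun b => b + w^-1%g b)%N Pb0) => b /and3P[/andP[ltab ltbc] lb nlb] maxb.
have lab : left u a b by rewrite leftN ?(ltn_ord_neq ltab).
have lcb : left u c b by apply: adj => //; rewrite (ltn_ord_neq ltbc).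
(* For u this pair fails at e = b itself: b lies to the right of c and below m = b + 1, but its
   final position is below k. *)
have nd : ~ drop_cond u w a c (w^-1%g b).+1 b.+1.
  case=> _ _ /(_ b); rewrite !(ltn_ord_neq ltab) !(ltn_ord_neq ltbc) => /(_ isT isT)[_].
  by move/(_ lcb (ltnSn _)); rewrite ltnn.
have mixed e f : left u' e f -> left u f e -> (f < e)%N -> left w f e -> False.
  by move=> l1 l2 ltef /(left_chain (keep' _ _ ltef l1)); rewrite left_irr.
apply: nd; apply: H; split.
- by rewrite ltnS ltnW // ltbc.
- by apply/andP; split; [exact: ltnW (keep _ _ ltbc lcb) | exact: keep' ltab lb].
(* For u', an offending e to the left of a would exceed b in label and final position while
   satisfying [P], against the maximality of b. *)
move=> e ea ec; split=> [lea lt_be | lce le_eb].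
  rewrite ltnNge; apply/negP => lt_wbe.
  have ltec : (e < c)%N.
    rewrite ltnNge; apply/negP => le_ce.
    have ltce : (c < e)%N by rewrite ltn_neqAle le_ce andbT eq_sym val_eqE.
    have lec := keep' _ _ ltce (left_chain lea lac').
    by have := left_chain (left_chain lec (keep _ _ ltbc lcb)) lt_wbe; rewrite left_irr.
  have ltae : (a < e)%N by apply: ltn_trans ltab _.
  have lwbe : left w b e by [].
  case lue : (left u e a).
    have l1 := left_chain lue lab.
    by have := left_chain (keep _ _ lt_be l1) lwbe; rewrite left_irr.
  have := maxb e; rewrite /P ltae ltec lea lue /= => /(_ isT).
  by move: lt_be lt_wbe; clear; lia.
have lteb : (e < b)%N.
  rewrite ltn_neqAle -ltnS le_eb andbT val_eqE.
  apply/eqP=> Eeb; rewrite Eeb in lce.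
  by have := left_chain lb (left_chain lac' lce); rewrite left_irr.
by apply: keep' lteb _; apply: left_chain lb (left_chain lac' lce).
Qed.

(** For an ascending R the prefix [run 1 A] is also its own Demazure product, so D is the Demazure
    product of R with one letter deleted. *)
Definition is_deletion R D :=
  exists A j B, R = A ++ j :: B /\ D = dem (run 1 A) B.

(** Delete from one word the letter where a and c meet; the other word has a deletion with the same
    D. Equal rank drops force it to be at the same pair (a, c), with the same labels between a and c
    lying to the left of a. *)
Lemma same_class_deletion R1 R2 : reduced R1 -> reduced R2 ->
    word_perm R1 = word_perm R2 -> (forall D, is_deletion R1 D <-> is_deletion R2 D) ->
  same_commutation_class R1 R2.
Proof.
move=> red1 red2 E12 Edel.
have Erun : run 1 R1 = run 1 R2 by rewrite /run E12.
have main S1 S2 a b c : reduced S1 -> reduced S2 -> run 1 S1 = run 1 S2 ->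
    (forall D, is_deletion S1 D -> is_deletion S2 D) ->
    (a < b < c)%N -> left (run 1 S1) c a -> ori 1 S1 a b c -> ori 1 S2 a b c.
  move=> r1 r2 E H ltabc lca [A1 [B1 [ES1 lba lac]]].
  have /andP[ltab ltbc] := ltabc; have ltac := ltn_trans ltab ltbc.
  have lac1 : left 1 a c by rewrite /left invg1 !perm1.
  have [A [j [B [ES Ea Ec]]]] := crossing lac1 lca.
  have [A' [j' [B' [ES' ED]]]] := H _ (ex_intro _ A (ex_intro _ j (ex_intro _ B (conj ES erefl)))).
  have a1 := reduced_asc r1; have a2 := reduced_asc r2.
  rewrite ES in a1 r1 E; rewrite ES' in a2 r2 E.
  have cr := crossesP a1; have cr' := crossesP a2.
  have d1 k m := rank_deleted k m r1.
  have d2 k m := rank_deleted k m r2.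
  rewrite /= Ea Ec E ED in cr cr' d1 d2.
  set u := run 1 A in cr d1 Ea Ec; set u' := run 1 A' in cr' d2.
  have d12 k m : drop_cond u (run 1 (A' ++ j' :: B')) a c k m <->
     drop_cond u' (run 1 (A' ++ j' :: B')) (u' (lo j')) (u' (hi j')) k m.
    by rewrite -d1 -d2.
  have [le1 le2] := drop_pair cr (fun k m => proj1 (d12 k m)).
  have [le3 le4] := drop_pair cr' (fun k m => proj2 (d12 k m)).
  have Ea' : u' (lo j') = a by apply: ord_inj; apply/eqP; rewrite eqn_leq le1.
  have Ec' : u' (hi j') = c by apply: ord_inj; apply/eqP; rewrite eqn_leq le4.
  rewrite Ea' Ec' in cr' d12.
  (* The witness prefix ends no later than the letter exchanging a and c, and b stays to the left of
     a from there on. *)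
  have lub : left u b a.
    rewrite ES in ES1; case: (prefix_cases ES1) => -[C [EA EB]].
      case: C EA EB lac lba => [|k C] EA EB lac; first by rewrite EA cats0.
      case: EB => Ek _ _; move: a1 lac; rewrite ES1 EA -Ek -catA run_cat asc_cat.
      rewrite run_cons => /andP[_ /= /andP[upj]].
      rewrite asc_cat => /andP[ascC _] l2.
      have := left_cross j (run 1 A); rewrite -/u Ea Ec => /(left_run ltac ascC).
      by move/(left_chain l2); rewrite left_irr.
    by move: a1; rewrite {1}EA asc_cat {1}asc_cat -andbA => /and3P[_ ascC _];
      rewrite /u EA run_cat; apply: left_run.
  exists A', (j' :: B'); split=> //; last by case: cr'.
  exact: (drop_left cr' cr (fun k m => proj1 (d12 k m))) ltabc lub.
apply: (same_class_ori (reduced_asc red1) (reduced_asc red2) Erun) => a b c lt l.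
split; first by apply: (main R1 R2) => // D /Edel.
rewrite Erun in l; apply: (main R2 R1) => // D; by move/Edel.
Qed.

End Ori.

(** * The weight polynomials *)

Section Weights.

Local Open Scope ring_scope.

Variable n : nat.
Implicit Types (x y u w D : 'S_n) (R A B : word n) (i j : 'I_n.-1).

(** The number of points over the cell of w as a polynomial in q, starting from a flag in the cell
    of x ([card_chains_wt]). *)
Fixpoint wt R x w : {poly rat} :=
  if R is i :: R' then 'X * wt R' (upper x i) w + wt R' (lower x i) w
  else (x == w)%:R%:P.

Lemma wt_cons i R x w :
  wt (i :: R) x w = 'X * wt R (upper x i) w + wt R (lower x i) w.
Proof. by []. Qed.

Lemma size_wt R x w : (size (wt R x w) <= (size R).+1)%N.
Proof.
elim: R x => [|i R IH] x /=; first exact: size_polyC_leq1.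
apply: leq_trans (size_polyD _ _) _; rewrite geq_max mulrC.
rewrite (leq_trans (IH _)) ?leqnSn // andbT.
have [->|nz] := eqVneq (wt R (upper x i) w) 0; first by rewrite mul0r size_poly0.
by rewrite size_mulX // ltnS IH.
Qed.

Lemma wt_lead R x w : (wt R x w)`_(size R) = (dem x R == w)%:R.
Proof.
elim: R x => [|i R IH] x /=; first by rewrite coefC eqxx.
by rewrite coefD coefXM /= IH nth_default ?addr0 // size_wt.
Qed.

(** The end points of the paths with exactly one [lower] step, with multiplicity. Along an ascending
    word that step does nothing, which amounts to deleting its letter. *)
Fixpoint deletions R x : seq 'S_n :=
  if R is i :: R' then dem (lower x i) R' :: deletions R' (upper x i) else [::].

Lemma wt_sublead i R x w :
  (wt (i :: R) x w)`_(size R) = (count_mem w (deletions (i :: R) x))%:R.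
Proof.
elim: R i x => [|j R IH] i x; rewrite wt_cons coefD coefXM wt_lead.
  by rewrite add0r /= addn0.
by rewrite [size _]/= IH [in RHS]/= natrD addrC.
Qed.

Lemma mem_deletions R D : asc 1 R -> D \in deletions R 1 <-> is_deletion R D.
Proof.
rewrite /is_deletion; move: (1%g : 'S_n) => x; elim: R x => [|i R IH] x /=.
  by move=> _; split=> // -[[|? ?] [? [? []]]].
move=> /andP[upx ascR]; rewrite inE {1}/lower {1}/upper upx; split.
  case/orP=> [/eqP->|/(IH _ ascR)[A [j [B [-> ->]]]]]; first by exists [::], i, R; rewrite run0.
  by exists (i :: A), j, B; rewrite run_cons.
case=> -[|i' A] [j [B [[Ei EB] ED]]]; first by rewrite ED EB run0 eqxx.
apply/orP; right; apply/(IH _ ascR); exists A, j, B.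
by rewrite -run_cons Ei.
Qed.

Lemma far_upper_lower x i j : far i j ->
  [/\ upper (upper x i) j = upper (upper x j) i,
      upper (lower x i) j = lower (upper x j) i,
      lower (upper x i) j = upper (lower x j) i
    & lower (lower x i) j = lower (lower x j) i].
Proof.
move=> fij; have fji : far j i by rewrite far_sym.
rewrite /upper /lower; case: (boolP (up x i)) => ui; case: (boolP (up x j)) => uj;
  by rewrite ?(up_far _ fij) ?(up_far _ fji) ?(negbTE ui) ?(negbTE uj) ?ui ?uj ?(swC_far _ fij).
Qed.

(** Far letters act on disjoint pairs of positions, so the four choices of [upper] or [lower] for i
    and j match in either order. *)
Lemma wt_move R R' x w : commutation_move R R' -> wt R x w = wt R' x w.
Proof.
move=> /commutation_moveP[A [B [i [j [fij -> ->]]]]].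
elim: A x => [|k A IH] x; last by rewrite /= !IH.
have [E1 E2 E3 E4] := far_upper_lower x fij.
by rewrite /= E1 E2 E3 E4 !mulrDr !addrA; congr (_ + _); rewrite addrAC.
Qed.

Lemma size_move R R' : commutation_move R R' -> size R = size R'.
Proof. by move=> [A [B [i [j [_ -> ->]]]]]; rewrite !size_cat. Qed.

Lemma wt_same_class R R' w x : same_commutation_class R R' ->
  wt R x w = wt R' x w /\ size R = size R'.
Proof.
elim=> [S T H|S //|S T U _ [-> ->] _ [-> ->] //].
by rewrite (wt_move _ _ H) (size_move H).
Qed.

(** * Polynomial identities from values at primes, and comparison of coefficients *)

Lemma many_primes N : exists s : seq nat, [/\ all prime s, uniq s & size s = N].
Proof.
elim: N => [|N [s [prs us szs]]]; first by exists [::].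
have [p ltp prp] := prime_above (\max_(m <- s) m).
exists (p :: s); rewrite /= prp prs us szs andbT; split=> //.
rewrite andbT; apply: contraL ltp => ps; rewrite -leqNgt.
exact: (@leq_bigmax_seq _ _ xpredT (fun m : nat => m)) ps _.
Qed.

Lemma poly_eq_primes (P Q : {poly rat}) :
  (forall p : nat, prime p -> P.[p%:R] = Q.[p%:R]) -> P = Q.
Proof.
move=> H; apply/eqP; rewrite -subr_eq0; apply: contraT => nz.
have [s [prs us szs]] := many_primes (size (P - Q)).
have := max_poly_roots (rs := [seq m%:R | m <- s]) nz.
rewrite size_map szs ltnn => -> //.
  by apply/allP=> _ /mapP[m ms ->]; rewrite rootE !hornerE H ?subrr ?(allP prs).
by rewrite map_inj_uniq // => a b /eqP; rewrite eqr_nat => /eqP.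
Qed.

Lemma wt_determines R1 R2 : reduced R1 -> reduced R2 ->
    (forall w, wt R1 1%g w * ('X + 1) ^+ size R2 = wt R2 1%g w * ('X + 1) ^+ size R1) ->
  same_commutation_class R1 R2.
Proof.
move=> red1 red2 H; have asc1 := reduced_asc red1; have asc2 := reduced_asc red2.
have X1E : ('X + 1 : {poly rat}) = 'X - (-1)%:P by rewrite polyCN opprK.
have monX1 : ('X + 1 : {poly rat}) \is monic.
  by rewrite X1E monicXsubC.
(* Degrees are compared in [H] at the permutation of R1: the left weight has full degree [size R1],
   so the right one has full degree [size R2], which by [wt_lead] happens only at the permutation of
   R2. *)
have E12 : word_perm R1 = word_perm R2.
  set w := run 1 R1.
  have lead1 : (wt R1 1%g w)`_(size R1) = 1 by rewrite wt_lead dem_asc // eqxx.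
  have size1 : size (wt R1 1%g w) = (size R1).+1.
    apply/eqP; rewrite eqn_leq size_wt ltnNge; apply/negP => le1.
    by move: lead1; rewrite nth_default // => /esym/eqP; rewrite oner_eq0.
  have nz1 : wt R1 1%g w != 0 by rewrite -size_poly_gt0 size1.
  have := congr1 (fun P : {poly rat} => size P) (H w).
  have szX (P : {poly rat}) m : P != 0 -> size (P * ('X + 1) ^+ m) = (size P + m)%N.
    move=> nzP; rewrite size_Mmonic ?monic_exp //.
    by rewrite X1E size_exp_XsubC addnS.
  have nz2 : wt R2 1%g w != 0.
    apply/eqP => E; have /eqP := H w; rewrite E mul0r mulf_eq0 (negbTE nz1).
    by rewrite expf_eq0 (negbTE (monic_neq0 monX1)) andbF.
  rewrite !szX // size1 addSn addnC -addSn => /addIn size2.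
  have : (wt R2 1%g w)`_(size R2) != 0.
    by rewrite -[size R2]/((size R2).+1.-1) size2 -lead_coefE lead_coef_eq0.
  rewrite wt_lead pnatr_eq0 eqb0 negbK dem_asc // => /eqP; rewrite /w /run.
  by rewrite !mulg1.
have Esz : size R1 = size R2 by rewrite -red1 -red2 E12.
have {}H w : wt R1 1%g w = wt R2 1%g w.
  have := H w; rewrite Esz; apply: mulIf; rewrite expf_eq0 (negbTE (monic_neq0 monX1)) andbF.
  by [].
apply: same_class_deletion => // D.
rewrite -!mem_deletions //.
(* Empty words have no deletions; otherwise the coefficient one degree below the length counts the
   deletions equal to D. *)
case: R1 R2 Esz H {red1 red2 asc1 asc2 E12} => [|i1 R1] [|i2 R2] //= [Esz] H.
have : (wt (i1 :: R1) 1%g D)`_(size R1) = (wt (i2 :: R2) 1%g D)`_(size R2).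
  by rewrite -Esz [wt _ _ _]H.
rewrite !wt_sublead => /eqP; rewrite eqr_nat => /eqP E.
have mE (s : seq 'S_n) : D \in s = (0 < count_mem D s)%N by rewrite -has_count has_pred1.
by rewrite ![D \in _]mE -![_ :: _]/(deletions (_ :: _) _) E.
Qed.

End Weights.

(** * Flags and Schubert cells *)

Section FlagCount.

Local Open Scope ring_scope.

Variables (F : finFieldType) (n : nat).
Local Notation V := 'cV[F]_n.
Local Notation flag := (subspace_seq F n).
Implicit Types (x y w : 'S_n) (R : word n) (i : 'I_n.-1) (f : flag) (g h : 'M[F]_n).
Implicit Types (v z : V) (k : 'I_n.+1) (j l : 'I_n).

Lemma basis_vecE l j : (basis_vec F l) j ord0 = (j == l)%:R.
Proof. by rewrite mxE andbT. Qed.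

Lemma mem_perm_flag w k v :
  v \in perm_flag F w k <-> forall j, (k <= w^-1%g j)%N -> v j ord0 = 0.
Proof.
rewrite ffunE; set X := [seq _ | _ <- _ & _]; split=> [Xv j lekj | v0].
  pose phi := linfun (mulmx (delta_mx ord0 j : 'M[F]_(1, n))) : 'Hom(V, 'M[F]_1).
  have phiE z : phi z = (z j ord0)%:M.
    by rewrite lfunE /= -rowE; apply/matrixP=> p q; rewrite !ord1 !mxE.
  have sX : (<<X>> <= lker phi)%VS.
    apply/span_subvP => u /mapP[l]; rewrite mem_filter => /andP[ltlk _] ->.
    rewrite memv_ker phiE basis_vecE; case: (j =P w l) => [Ej|_]; last by rewrite mulr0n raddf0.
    by rewrite Ej permK leqNgt ltlk in lekj.
  have := subvP sX _ Xv; rewrite memv_ker phiE => /eqP/matrixP/(_ ord0 ord0).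
  by rewrite !mxE.
rewrite (matrix_sum_delta v) memv_suml // => j _; rewrite big_ord1.
have [lekj|ltjk] := leqP k (w^-1%g j); first by rewrite v0 // scale0r mem0v.
rewrite memvZ // memv_span //; apply/mapP; exists (w^-1%g j); last by rewrite permKV.
by rewrite mem_filter ltjk mem_enum.
Qed.

Lemma perm_flag_eq w w' k :
    (forall j, (k <= w^-1%g j)%N = (k <= w'^-1%g j)%N) ->
  perm_flag F w k = perm_flag F w' k.
Proof.
by move=> E; apply/vspaceP=> v; apply/idP/idP => /mem_perm_flag v0;
  apply/mem_perm_flag => j; [rewrite -E | rewrite E]; apply: v0.
Qed.

Lemma dim_perm_flag w k : \dim (perm_flag F w k) = k.
Proof.
rewrite ffunE; set e := fun j => basis_vec F (w j).
have spanf : (fullv <= <<[seq e j | j <- enum 'I_n]>>)%VS.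
  apply/subvP=> v _; rewrite (matrix_sum_delta v) memv_suml // => j _.
  rewrite big_ord1 memvZ // memv_span //; apply/mapP; exists (w^-1%g j).
    by rewrite mem_enum.
  by rewrite /e permKV.
have frees : free [seq e j | j <- enum 'I_n].
  apply: (basis_free (U := fullv)); rewrite basisEdim spanf size_map size_enum_ord.
  by rewrite dimvf /dim /= muln1.
have freek : free [seq e j | j <- enum 'I_n & (j < k)%N].
  apply: (@catl_free _ _ [seq e j | j <- [seq j <- enum 'I_n | predC (fun j : 'I_n => j < k)%N j]]).
  rewrite -map_cat (perm_free (Y := [seq e j | j <- enum 'I_n])) //.
  by rewrite perm_map // perm_filterC.
rewrite (eqnP freek) size_map size_filter.
rewrite -(count_map (fun j : 'I_n => j : nat) (fun m => m < k)%N) val_enum_ord.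
have lekn : (k <= n)%N by rewrite -ltnS.
have -> : iota 0 n = iota 0 k ++ iota k (n - k).
  by rewrite -[in LHS](subnKC lekn) iotaD add0n.
rewrite count_cat (eq_in_count (a2 := predT)) ?count_predT ?size_iota; last first.
  by move=> m; rewrite mem_iota /= add0n => ->.
rewrite (eq_in_count (a2 := pred0)) ?count_pred0 ?addn0 // => m.
by rewrite mem_iota => /andP[le _]; rewrite ltnNge le.
Qed.

Lemma perm_flag_sub w k (k' : 'I_n.+1) : (k <= k')%N ->
  (perm_flag F w k <= perm_flag F w k')%VS.
Proof.
move=> lekk; apply/subvP=> v /mem_perm_flag v0; apply/mem_perm_flag => j le'.
by apply: v0; apply: leq_trans le'.
Qed.

Lemma perm_flag_flag w : is_flag (perm_flag F w).
Proof.
apply/andP; split; first by apply/forallP=> k; rewrite dim_perm_flag.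
by apply/forallP=> k; apply/forallP=> k'; apply/implyP; apply: perm_flag_sub.
Qed.

Lemma flag_actM g h f : flag_act (g *m h) f = flag_act g (flag_act h f).
Proof.
apply/ffunP=> k; rewrite !ffunE -limg_comp; congr (_ @: _)%VS.
by apply/lfunP=> v; rewrite comp_lfunE !lfunE /= mulmxA.
Qed.

Lemma flag_act1 f : flag_act 1%:M f = f.
Proof.
apply/ffunP=> k; rewrite ffunE -[RHS]lim1g; congr (_ @: _)%VS.
by apply/lfunP=> v; rewrite !lfunE /= mul1mx.
Qed.

Lemma mem_flag_act g f k v : g \in unitmx ->
  (v \in flag_act g f k) = (invmx g *m v \in f k).
Proof.
move=> ug; rewrite ffunE; apply/memv_imgP/idP => [[z fz ->]|fv].
  by rewrite lfunE /= mulKmx.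
by exists (invmx g *m v); rewrite // lfunE /= mulKVmx.
Qed.

Lemma is_flag_act g f : g \in unitmx -> is_flag f -> is_flag (flag_act g f).
Proof.
move=> ug /andP[/forallP dimf /forallP subf]; apply/andP; split.
  apply/forallP=> k; rewrite ffunE limg_dim_eq //.
  apply/eqP; rewrite -subv0; apply/subvP=> v; rewrite memv_cap memv_ker lfunE /= memv0.
  by case/andP=> _ /eqP gv0; rewrite -[v](mulKmx ug) gv0 mulmx0.
apply/forallP=> k; apply/forallP=> k'; apply/implyP=> lekk.
by rewrite !ffunE limgS // (implyP (forallP (subf k) k')).
Qed.

(** * The Borel group and the disjointness of Schubert cells *)

Lemma borel_unit g : g \in borel F n -> g \in unitmx.
Proof. by rewrite inE => /andP[]. Qed.

Lemma borel_upper g (p q : 'I_n) : g \in borel F n -> (q < p)%N -> g p q = 0.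
Proof. by rewrite inE => /andP[_ /forallP/(_ p)/forallP/(_ q)/implyP H] /H/eqP. Qed.

Lemma borelM g h : g \in borel F n -> h \in borel F n -> g *m h \in borel F n.
Proof.
move=> bg bh; rewrite inE unitmx_mul !borel_unit //=.
apply/forallP=> p; apply/forallP=> q; apply/implyP=> ltqp; rewrite mxE big1 // => l _.
have [ltlp|lepl] := ltnP l p; first by rewrite (borel_upper bg) ?mul0r.
by rewrite (borel_upper bh) ?mulr0 // (leq_trans ltqp).
Qed.

Lemma borel1 : 1%:M \in borel F n.
Proof.
rewrite inE unitmx1; apply/forallP=> p; apply/forallP=> q; apply/implyP=> ltqp.
by rewrite mxE -val_eqE gtn_eqF.
Qed.

Lemma borel_diag g j : g \in borel F n -> g j j != 0.
Proof.
move=> bg; have := borel_unit bg; rewrite unitmxE unitfE -det_tr det_trig.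
  by move=> /prodf_neq0/(_ j isT); rewrite mxE.
by apply/is_trig_mxP => p q ltpq; rewrite mxE (borel_upper bg).
Qed.

(** The index of the last nonzero coordinate serves as an invariant of v under invertible upper
    triangular matrices. *)
Definition leads v l := (v l ord0 != 0) && [forall j : 'I_n, (l < j)%N ==> (v j ord0 == 0)].

Lemma leadsP v l : reflect (v l ord0 != 0 /\ forall j, (l < j)%N -> v j ord0 = 0) (leads v l).
Proof.
apply: (iffP andP) => -[nz H]; split=> //.
  by move=> j ltlj; apply/eqP; apply: (implyP (forallP H j)).
by apply/forallP=> j; apply/implyP=> /H->.
Qed.

Lemma leads_inj v l l' : leads v l -> leads v l' -> l = l'.
Proof.
move=> /leadsP[nz H] /leadsP[nz' H']; apply: ord_inj; case: (ltngtP l l') => // lt.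
  by rewrite H ?eqxx in nz'.
by rewrite H' ?eqxx in nz.
Qed.

Lemma leads_borel g v l : g \in borel F n -> leads v l -> leads (g *m v) l.
Proof.
move=> bg /leadsP[nz H]; apply/leadsP; split=> [|j ltlj]; rewrite mxE.
  rewrite (bigD1 l) //= big1 ?addr0 ?mulf_neq0 ?borel_diag // => p pl.
  case: (ltngtP p l) => [lt|lt|/ord_inj E]; last by rewrite E eqxx in pl.
    by rewrite (borel_upper bg) ?mul0r.
  by rewrite H ?mulr0.
rewrite big1 // => p _; case: (ltnP p j) => [lt|le].
  by rewrite (borel_upper bg) ?mul0r.
by rewrite H ?mulr0 // (leq_trans ltlj).
Qed.

Lemma leads_exists v : v != 0 -> exists l, leads v l.
Proof.
move=> nzv; have /existsP[l0 nz0] : [exists l : 'I_n, v l ord0 != 0].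
  apply: contraNT nzv; rewrite negb_exists => /forallP H.
  by apply/eqP/matrixP=> p q; rewrite ord1 mxE; apply/eqP; rewrite -[_ == _]negbK.
case: (@arg_maxnP _ l0 (fun l => v l ord0 != 0) (fun l => l : nat) nz0) => l nzl maxl.
exists l; apply/leadsP; split=> // j; rewrite ltnNge => nle; apply/eqP.
by apply: contraNT nle => /maxl.
Qed.

Lemma perm_le1 (s : 'S_n) : (forall p, s p <= p)%N -> s = 1%g.
Proof.
move=> les; apply/permP=> p; rewrite perm1.
elim: {p}(p : nat).+1 {-2}p (ltnSn p) => // m IH p; rewrite ltnS => lepm.
have := les p; rewrite leq_eqVlt => /orP[/eqP/ord_inj//|ltsp].
by apply: perm_inj; apply: IH; apply: leq_trans lepm.
Qed.

(** For each p, the image under g of the basis vector of index [x p] lies in the subspace of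
    dimension p + 1 of the flag of w moved by h. Leading indices survive g and h, so [x p] is among
    the first p + 1 values of w, and [perm_le1] applies. *)
Lemma schubert_cell_inj f x w :
  f \in schubert_cell F x -> f \in schubert_cell F w -> x = w.
Proof.
case/imsetP=> g bg -> /imsetP[h bh E].
suff /perm_le1 /(congr1 (fun s => s * w)%g) : forall p, ((x * w^-1)%g p <= p)%N.
  by rewrite mulgKV mul1g.
move=> p; rewrite permM.
have lep : (p.+1 < n.+1)%N by rewrite ltnS.
pose k : 'I_n.+1 := Ordinal lep.
have ex : basis_vec F (x p) \in perm_flag F x k.
  apply/mem_perm_flag=> j /= ltpj; rewrite basis_vecE; case: eqP => // E'.
  by rewrite E' permK ltnn in ltpj.
have lx : leads (basis_vec F (x p)) (x p).
  apply/leadsP; rewrite basis_vecE eqxx oner_eq0; split=> // j ltj.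
  by rewrite basis_vecE -val_eqE gtn_eqF.
have : g *m basis_vec F (x p) \in flag_act g (perm_flag F x) k.
  by rewrite mem_flag_act ?mulKmx // borel_unit.
rewrite E mem_flag_act ?borel_unit //; set v := invmx h *m _ => Ev.
have Ehv : h *m v = g *m basis_vec F (x p) by rewrite mulKVmx ?borel_unit.
have lgx := leads_borel bg lx.
have nzv : v != 0.
  apply/eqP => v0; move: lgx => /leadsP[]; rewrite -Ehv v0 mulmx0 mxE eqxx //.
have [l lv] := leads_exists nzv.
have El : l = x p by apply: leads_inj (leads_borel bh lv) _; rewrite Ehv.
rewrite -ltnS -El ltnNge; apply/negP => le.
by case/leadsP: lv => /eqP[]; apply: (proj1 (mem_perm_flag _ _ _) Ev l le).
Qed.

End FlagCount.

(** * Flags differing in one dimension *)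

Section Neighbours.

Local Open Scope ring_scope.

Variables (F : finFieldType) (n : nat).
Local Notation V := 'cV[F]_n.
Local Notation flag := (subspace_seq F n).
Implicit Types (x y w : 'S_n) (R : word n) (i : 'I_n.-1) (f : flag) (g h : 'M[F]_n).
Implicit Types (v z : V) (k : 'I_n.+1) (j l : 'I_n) (t s : F).

Definition adjacent i f f' :=
  [forall k : 'I_n.+1, (k != i.+1 :> nat) ==> (f k == f' k)].

Lemma adjacentP i f f' :
  reflect (forall k, k != i.+1 :> nat -> f k = f' k) (adjacent i f f').
Proof.
apply: (iffP forallP) => H k; last by apply/implyP=> /H->.
by move=> ki; apply/eqP; apply: implyP (H k) ki.
Qed.

Lemma lower_upper x i : lower x i = sw i (upper x i).
Proof. by rewrite /lower /upper; case: ifP => // _; rewrite swK. Qed.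

Lemma upper_descent x i : (upper x i (hi i) < upper x i (lo i))%N.
Proof.
rewrite /upper; case: ifP => [|/negbT]; rewrite /up.
  by rewrite !swE simple_transp_lo simple_transp_hi.
rewrite -leqNgt leq_eqVlt => /orP[/eqP/ord_inj/perm_inj/(congr1 val) /=|//].
by clear; lia.
Qed.

Lemma perm_flag_sw x i k : k != i.+1 :> nat ->
  perm_flag F (sw i x) k = perm_flag F x k.
Proof.
move=> ki; apply: perm_flag_eq => j; rewrite sw_inv.
by move: (x^-1%g j) ki => p; clear; transp_lia.
Qed.

Lemma perm_flag_upper x i k : k != i.+1 :> nat ->
  perm_flag F (upper x i) k = perm_flag F x k.
Proof. by move=> ki; rewrite /upper; case: ifP => // _; apply: perm_flag_sw. Qed.

(** A root subgroup. When y has a descent at i, the added entry lies above the diagonal, so the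
    matrix is in [borel]. *)
Definition transv y i t : 'M[F]_n := 1%:M + t *: delta_mx (y (hi i)) (y (lo i)).

Section Descent.

Variables (y : 'S_n) (i : 'I_n.-1).
Hypothesis desc : (y (hi i) < y (lo i))%N.

Let neq_lohi : (y (lo i) == y (hi i)) = false.
Proof. by apply/negbTE; rewrite -val_eqE neq_ltn desc orbT. Qed.

Lemma transv_mul t v j :
  (transv y i t *m v) j ord0 = v j ord0 + t * (j == y (hi i))%:R * v (y (lo i)) ord0.
Proof.
rewrite mulmxDl mul1mx -scalemxAl mxE mxE -mulrA; congr (_ + t * _).
rewrite mxE (bigD1 (y (lo i))) //= mxE eqxx andbT big1 ?addr0 // => l ne.
by rewrite mxE (negbTE ne) andbF mul0r.
Qed.

Lemma transvD s t : transv y i s *m transv y i t = transv y i (s + t).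
Proof.
rewrite /transv mulmxDl mul1mx mulmxDr mulmx1 -scalemxAl -scalemxAr mul_delta_mx_cond.
by rewrite neq_lohi mulr0n !scaler0 addr0 scalerDl addrA addrAC.
Qed.

Lemma transv0 : transv y i 0 = 1%:M.
Proof. by rewrite /transv scale0r addr0. Qed.

Lemma transv_unit t : transv y i t \in unitmx.
Proof.
by have := mulmx1_unit (etrans (transvD t (- t)) (etrans (congr1 _ (addrN t)) transv0)) => -[].
Qed.

Lemma transv_inv t : invmx (transv y i t) = transv y i (- t).
Proof.
apply: (can_inj (mulKmx (transv_unit t))).
by rewrite mulmxV ?transv_unit // transvD addrN transv0.
Qed.

Lemma transv_borel t : transv y i t \in borel F n.
Proof.
rewrite inE transv_unit; apply/forallP=> p; apply/forallP=> q; apply/implyP=> ltqp.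
rewrite !mxE -val_eqE gtn_eqF //= add0r.
case: (p =P _) => [Ep|_] /=; last by rewrite mulr0.
case: (q =P _) => [Eq|_] /=; last by rewrite mulr0.
by move: ltqp; rewrite Ep Eq ltnNge ltnW.
Qed.

Lemma transv_perm_flag t k v : k != i.+1 :> nat ->
  v \in perm_flag F y k -> transv y i t *m v \in perm_flag F y k.
Proof.
move=> ki /mem_perm_flag v0; apply/mem_perm_flag => j lekj.
rewrite transv_mul v0 // add0r; case: eqP => [Ej|_]; last by rewrite mulr0 mul0r.
rewrite v0 ?mulr0 //; move: lekj; rewrite Ej !permK /=.
by rewrite leq_eqVlt (negbTE ki).
Qed.

(** [option F] is the projective line of flags adjacent to that of y: [Some t] gives the q points in
    the cell of y, and [None] the one in the cell of [sw i y]. *)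
Definition neighbour (o : option F) : flag :=
  if o is Some t then flag_act (transv y i t) (perm_flag F y) else perm_flag F (sw i y).

Lemma neighbour_far o k : k != i.+1 :> nat -> neighbour o k = perm_flag F y k.
Proof.
move=> ki; case: o => [t|] /=; last exact: perm_flag_sw.
apply/vspaceP=> v; rewrite mem_flag_act ?transv_unit // transv_inv.
apply/idP/idP; last exact: transv_perm_flag.
move=> /(transv_perm_flag t ki); rewrite mulmxA transvD addrN transv0 mul1mx //.
Qed.

Lemma neighbour_flag o : is_flag (neighbour o).
Proof.
case: o => [t|]; last exact: perm_flag_flag.
by apply: is_flag_act; [apply: transv_unit | apply: perm_flag_flag].
Qed.

Let kS : 'I_n.+1 := inord i.+1.

Let kSE : kS = i.+1 :> nat.
Proof. by rewrite inordK // ltnS ltnW // letterS_proof. Qed.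

(* At dimension i + 1, the subspaces between perm_flag y i and perm_flag y (i + 2)
   are given by the ratio of the coordinates y (hi i) and y (lo i). *)
Lemma mem_neighbour o v : v \in neighbour o kS <->
  (forall j, (i.+2 <= y^-1%g j)%N -> v j ord0 = 0) /\
  (if o is Some t then v (y (hi i)) ord0 = t * v (y (lo i)) ord0
   else v (y (lo i)) ord0 = 0).
Proof.
have posE j : ((i.+1 <= y^-1%g j) = (i.+2 <= y^-1%g j) || (j == y (hi i)))%N.
  rewrite leq_eqVlt orbC; congr (_ || _).
  by rewrite -[j in RHS](permKV y) (inj_eq perm_inj) -val_eqE eq_sym.
case: o => [t|] /=.
  rewrite mem_flag_act ?transv_unit // transv_inv mem_perm_flag; split=> [H|[H1 H2] j].
    split=> [j lej|].
      have := H j; rewrite kSE posE lej => /(_ isT); rewrite transv_mul.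
      case: eqP => [Ej|_]; last by rewrite mulr0 mul0r addr0.
      by move: lej; rewrite Ej permK /= ltnn.
    have := H (y (hi i)); rewrite permK kSE leqnn => /(_ isT).
    by rewrite transv_mul eqxx mulr1 mulNr => /eqP; rewrite subr_eq0 => /eqP.
  rewrite kSE posE transv_mul; case: eqP => [->|_] /=.
    by rewrite H2 mulr1 mulNr subrr.
  by rewrite orbF => /H1->; rewrite mulr0 mul0r addr0.
rewrite mem_perm_flag; have pos' j :
    ((kS <= (sw i y)^-1%g j) = (i.+2 <= y^-1%g j) || (j == y (lo i)))%N.
  rewrite kSE sw_inv -[j in (j == _)](permKV y) (inj_eq perm_inj) -val_eqE /=.
  by move: (y^-1%g j) => p; clear; transp_lia.
split=> [H|[H1 H2] j]; last by rewrite pos' => /orP[/H1|/eqP->].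
by split=> [j lej|]; apply: H; rewrite pos' ?eqxx ?orbT // lej.
Qed.

Lemma neighbour_inj : injective neighbour.
Proof.
move=> o o' E; have Em v : v \in neighbour o kS <-> v \in neighbour o' kS by rewrite E.
have memN : basis_vec F (y (hi i)) \in neighbour None kS.
  apply/mem_neighbour; rewrite basis_vecE neq_lohi; split=> // j le.
  rewrite basis_vecE; case: eqP => // Ej; move: le; rewrite Ej permK /= ltnn //.
have nmemS t : ~ basis_vec F (y (hi i)) \in neighbour (Some t) kS.
  move/mem_neighbour=> [_]; rewrite !basis_vecE eqxx neq_lohi mulr0 => /eqP.
  by rewrite oner_eq0.
case: o o' {E} Em => [t|] [s|] Em //; last 2 first.
- by case: (nmemS t); apply/Em.
- by case: (nmemS s); apply/Em.
(* A vector in the subspace for t whose coordinate ratio is t, so that it separates t from s. *)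
pose v : V := basis_vec F (y (lo i)) + t *: basis_vec F (y (hi i)).
have vE j : v j ord0 = (j == y (lo i))%:R + t * (j == y (hi i))%:R.
  by rewrite !mxE !andbT.
have /Em/mem_neighbour[_] : v \in neighbour (Some t) kS.
  apply/mem_neighbour; split=> [j le|].
    rewrite vE; case: eqP => [Ej|_]; first by move: le; rewrite Ej permK /= ltnNge leqnSn.
    case: eqP => [Ej|_]; first by move: le; rewrite Ej permK /= ltnn.
    by rewrite mulr0 addr0.
  by rewrite !vE !eqxx (eq_sym (y (hi i))) neq_lohi /= mulr0 addr0 add0r.
by rewrite !vE !eqxx (eq_sym (y (hi i))) neq_lohi /= mulr0 addr0 add0r !mulr1 => ->.
Qed.

Lemma adjacent_neighbour f : is_flag f -> adjacent i (perm_flag F y) f ->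
  exists o, f = neighbour o.
Proof.
move=> flf /adjacentP adj; have /andP[/forallP dimf /forallP subf] := flf.
have lt0 : (i < n.+1)%N by rewrite ltnS ltnW // letter_proof.
have lt2 : (i.+2 < n.+1)%N by rewrite ltnS letterS_proof.
pose k0 : 'I_n.+1 := Ordinal lt0; pose k2 : 'I_n.+1 := Ordinal lt2.
have sub02 : (perm_flag F y k0 <= f kS)%VS.
  rewrite adj; last by rewrite neq_ltn ltnSn.
  by apply: (implyP (forallP (subf k0) kS)); rewrite kSE /=.
have sub2 : (f kS <= perm_flag F y k2)%VS.
  rewrite adj; last by rewrite neq_ltn ltnSn orbT.
  by apply: (implyP (forallP (subf kS) k2)); rewrite kSE /=.
(* The coordinates of v at [y (lo i)] and [y (hi i)] will determine the point o of the projective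
   line. *)
have [v fv n0v] : exists2 v, v \in f kS & v \notin perm_flag F y k0.
  apply/subvPn; apply/negP => /dimvS; rewrite (eqP (dimf kS)) dim_perm_flag kSE /=.
  by rewrite ltnn.
have v2 j : (i.+2 <= y^-1%g j)%N -> v j ord0 = 0.
  by move: (subvP sub2 _ fv) => /mem_perm_flag H /H.
have ker0 z : (forall j, (i.+2 <= y^-1%g j)%N -> z j ord0 = 0) ->
    z (y (lo i)) ord0 = 0 -> z (y (hi i)) ord0 = 0 -> z \in perm_flag F y k0.
  move=> z2 zlo zhi; apply/mem_perm_flag => j /= le.
  have [/z2//|] := leqP i.+2 (y^-1%g j); rewrite ltnS => le'.
  have [E|E] : y^-1%g j = lo i \/ y^-1%g j = hi i.
    move: le le'; rewrite leq_eqVlt => /orP[/eqP E _|lt1 le1].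
      by left; apply: ord_inj.
    by right; apply/ord_inj/eqP; rewrite eqn_leq le1.
  - by rewrite -[j](permKV y) E.
  - by rewrite -[j](permKV y) E.
suff [o sub] : exists o, (neighbour o kS <= f kS)%VS.
  exists o; apply/ffunP=> k; have [Ek|ki] := eqVneq (k : nat) i.+1; last first.
    by rewrite neighbour_far // adj.
  have -> : k = kS by apply: ord_inj; rewrite Ek kSE.
  apply/esym/eqP; rewrite eqEdim sub (eqP (dimf kS)).
  by have /andP[/forallP/(_ kS)/eqP E _] := neighbour_flag o; rewrite E leqnn.
(* In both cases, subtracting from z the multiple of v that agrees with it at one of the two
   coordinates kills both, and the remainder lies in the smaller subspace. *)
have [vlo|vlo] := eqVneq (v (y (lo i)) ord0) 0; last first.
  exists (Some (v (y (hi i)) ord0 / v (y (lo i)) ord0)).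
  apply/subvP=> z /mem_neighbour[z2 zhi].
  rewrite -(subrK ((z (y (lo i)) ord0 / v (y (lo i)) ord0) *: v) z).
  rewrite rpredD ?rpredZ // (subvP sub02) //; apply: ker0 => [j le||].
  - by rewrite !mxE (z2 j) // (v2 j) // mulr0 subrr.
  - by rewrite !mxE mulfVK // subrr.
  - rewrite !mxE zhi; apply/eqP; rewrite subr_eq0; apply/eqP.
    by rewrite mulrAC [RHS]mulrAC [z _ _ * _]mulrC.
exists None; apply/subvP=> z /mem_neighbour[z2 zlo].
have vhi : v (y (hi i)) ord0 != 0 by apply: contraNneq n0v => vhi; apply: ker0.
rewrite -(subrK ((z (y (hi i)) ord0 / v (y (hi i)) ord0) *: v) z).
rewrite rpredD ?rpredZ // (subvP sub02) //; apply: ker0 => [j le||].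
- by rewrite !mxE (z2 j) // (v2 j) // mulr0 subrr.
- by rewrite !mxE zlo vlo mulr0 subrr.
- by rewrite !mxE mulfVK // subrr.
Qed.

End Descent.

Lemma adjacent_act g i f f' : adjacent i f f' -> adjacent i (flag_act g f) (flag_act g f').
Proof. by move=> /adjacentP adj; apply/adjacentP => k ki; rewrite !ffunE adj. Qed.

(** The flags adjacent to that of x are those adjacent to that of [upper x i], which has a descent
    at i and is covered by [neighbour]; g only translates. The weight c is arbitrary, so that it can
    be the number of continuations of a chain. *)
Lemma sum_neighbours (c : flag -> nat) g x i : g \in borel F n ->
  (\sum_(f | is_flag f && adjacent i (flag_act g (perm_flag F x)) f) c f =
   c (flag_act g (perm_flag F (lower x i))) +
   \sum_(t : F) c (flag_act (g *m transv (upper x i) i t) (perm_flag F (upper x i))))%N.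
Proof.
move=> bg; have ug := borel_unit bg; have desc := upper_descent x i.
set y := upper x i in desc *.
pose nb o := flag_act g (neighbour y i o).
have injnb : injective nb.
  move=> o o' E; apply: (neighbour_inj desc).
  rewrite -(flag_act1 (neighbour y i o)) -(flag_act1 (neighbour y i o')).
  by rewrite -(mulVmx ug) !flag_actM -!/(nb _) E.
have adjE f : is_flag f && adjacent i (flag_act g (perm_flag F x)) f =
    (f \in nb None |: [set nb (Some t) | t in F]).
  apply/andP/idP=> [[flf adjf]|].
    have [||o Eo] := adjacent_neighbour desc (f := flag_act (invmx g) f).
    - by apply: is_flag_act; rewrite ?unitmx_inv.
    - have /adjacentP adj' := adjacent_act (invmx g) adjf; apply/adjacentP => k ki.
      by rewrite perm_flag_upper // -adj' // -flag_actM mulVmx // flag_act1.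
    have -> : f = nb o by rewrite /nb -Eo -flag_actM mulmxV // flag_act1.
    rewrite !inE; case: o {Eo} => [t|]; last by rewrite eqxx.
    by apply/orP; right; apply/imsetP; exists t.
  have nbP o : is_flag (nb o) /\ adjacent i (flag_act g (perm_flag F x)) (nb o).
    split; first by apply: is_flag_act => //; apply: neighbour_flag.
    apply: adjacent_act; apply/adjacentP => k ki.
    by rewrite neighbour_far // perm_flag_upper.
  by rewrite !inE => /orP[/eqP->|/imsetP[t _ ->]]; apply: nbP.
rewrite (eq_bigl _ _ adjE) big_setU1; last first.
  by apply/imsetP=> -[t _ /injnb].
rewrite lower_upper -/y; congr (_ + _)%N.
rewrite big_imset /=; last by move=> s t _ _ /injnb[].
by apply: eq_bigr => t _; rewrite /nb /= flag_actM.
Qed.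

End Neighbours.

(** * Counting points of Bott-Samelson varieties *)

Section Chains.

Variable T : finType.
Implicit Types (m : nat) (f : T) (Q : pred T).

(** The relation depends on the step, so that a chain without its first member is again a chain, for
    the shifted relations. *)
Definition chains m (E : 'I_m -> rel T) f Q : {set {ffun 'I_m.+1 -> T}} :=
  [set Fs : {ffun 'I_m.+1 -> T} |
    [&& Fs ord0 == f,
        [forall r : 'I_m, E r (Fs (widen_ord (leqnSn _) r)) (Fs (lift ord0 r))]
      & Q (Fs ord_max)]].

Lemma eq_chains m (E E' : 'I_m -> rel T) f Q :
  (forall r, E r =2 E' r) -> chains E f Q = chains E' f Q.
Proof.
move=> EE; apply/setP=> Fs; rewrite !inE; congr [&& _, _ & _].
by apply: eq_forallb => r; rewrite EE.
Qed.

Lemma card_chains0 (E : 'I_0 -> rel T) f Q : #|chains E f Q| = Q f.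
Proof.
have chE Fs : (Fs \in chains E f Q) = (Fs == [ffun=> f]) && Q f.
  rewrite inE; have -> : [forall r, E r (Fs (widen_ord (leqnSn 0) r)) (Fs (lift ord0 r))].
    by apply/forallP=> -[].
  have -> : (Fs == [ffun=> f]) = (Fs ord0 == f).
    apply/eqP/eqP => [->|E0]; first by rewrite ffunE.
    by apply/ffunP=> r; rewrite ffunE ord1.
  by rewrite (ord1 ord_max); case: eqP => [->|].
case Qf: (Q f) chE => chE.
  by rewrite (eq_card (B := pred1 [ffun=> f])) ?card1 // => Fs; rewrite chE andbT.
by rewrite (eq_card (B := pred0)) ?card0 // => Fs; rewrite chE andbF.
Qed.

Definition ffcons m f (G : {ffun 'I_m.+1 -> T}) : {ffun 'I_m.+2 -> T} :=
  [ffun r => if unlift ord0 r is Some r' then G r' else f].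

Lemma ffcons0 m f (G : {ffun 'I_m.+1 -> T}) : ffcons f G ord0 = f.
Proof. by rewrite ffunE unlift_none. Qed.

Lemma ffconsS m f (G : {ffun 'I_m.+1 -> T}) r : ffcons f G (lift ord0 r) = G r.
Proof. by rewrite ffunE liftK. Qed.

Lemma card_chainsS m (E : 'I_m.+1 -> rel T) f Q :
  #|chains E f Q| =
  \sum_(f1 | E ord0 f f1) #|chains (fun r => E (lift ord0 r)) f1 Q|.
Proof.
have w0 : widen_ord (leqnSn m.+1) ord0 = ord0 by apply: val_inj.
have wS (r : 'I_m) : widen_ord (leqnSn m.+1) (lift ord0 r) = lift ord0 (widen_ord (leqnSn m) r).
  exact: val_inj.
have omax : ord_max = lift ord0 ord_max :> 'I_m.+2 by apply: val_inj.
pose second (Fs : {ffun 'I_m.+2 -> T}) := Fs (lift ord0 ord0).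
rewrite -sum1_card (partition_big second (E ord0 f)) /=; last first.
  by move=> Fs; rewrite inE => /and3P[/eqP<- /forallP/(_ ord0)]; rewrite w0.
apply: eq_bigr => f1 Ef1; rewrite sum1dep_card.
have inj_cons : injective (@ffcons m f).
  by move=> G G' EG; apply/ffunP=> r; rewrite -(ffconsS f G) EG ffconsS.
rewrite -(card_imset (mem (chains (fun r => E (lift ord0 r)) f1 Q)) inj_cons).
apply: eq_card => Fs; rewrite inE; apply/andP/imsetP => [[]|[G]]; rewrite !inE.
  case/and3P=> [/eqP F0 /forallP FE QF] /eqP F1; rewrite /second in F1.
  exists [ffun r => Fs (lift ord0 r)].
    rewrite inE !ffunE F1 eqxx -omax QF andbT; apply/forallP=> r.
    by rewrite !ffunE -wS FE.
  apply/ffunP=> r; case: (unliftP ord0 r) => [r'|] ->; last by rewrite ffcons0.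
  by rewrite ffconsS ffunE.
case/and3P=> [/eqP G0 /forallP GE QG] ->.
rewrite /second ffcons0 ffconsS G0 omax ffconsS QG !eqxx andbT.
split=> //; apply/forallP=> r; case: (unliftP ord0 r) => [r'|] ->.
  by rewrite wS !ffconsS GE.
by rewrite w0 ffcons0 ffconsS G0.
Qed.

End Chains.

Section Count.

Local Open Scope ring_scope.

Variables (F : finFieldType) (n : nat).
Implicit Types (x w : 'S_n) (R : word n).

Definition bs_step R (r : 'I_(size R)) (f f' : subspace_seq F n) :=
  is_flag f' && adjacent (tnth (in_tuple R) r) f f'.

(** The start is any Borel translate because stepping to a neighbour [Some t] multiplies g by a
    transvection. All flags of a cell thus have equal counts, and [sum_neighbours] becomes the
    recursion of [wt]. *)
Lemma card_chains_wt R x w g : g \in borel F n ->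
  #|chains (@bs_step R) (flag_act g (perm_flag F x)) (mem (schubert_cell F w))|%:R
    = (wt R x w).[#|F|%:R].
Proof.
elim: R x g => [|i R IH] x g bg.
  rewrite card_chains0 hornerC; congr (_%:R).
  apply: (congr1 nat_of_bool); apply/idP/eqP => [|<-]; last by apply/imsetP; exists g.
  by move=> cw; apply: schubert_cell_inj cw; apply/imsetP; exists g.
rewrite card_chainsS.
pose c f := #|chains (@bs_step R) f (mem (schubert_cell F w))|.
rewrite (eq_bigr c) => [|f _]; last first.
  (* Here [i] is the default value for [nth], through which letter r + 1 of [i :: R] is identified
     with letter r of R. *)
  by congr #|pred_of_set _|; apply: eq_chains => r f1 f2; rewrite /bs_step !(tnth_nth i).
rewrite [X in X%:R](sum_neighbours c x i bg) natrD natr_sum wt_cons !hornerE.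
rewrite {1}/c IH // addrC; congr (_ + _).
rewrite (eq_bigr (fun=> (wt R (upper x i) w).[#|F|%:R])) => [|t _]; last first.
  by rewrite /c IH // borelM // transv_borel // upper_descent.
by rewrite sumr_const mulr_natl.
Qed.

Lemma std_flagE : std_flag F n = perm_flag F 1.
Proof.
by apply/ffunP=> k; rewrite !ffunE; congr <<_>>%VS; apply: eq_map => j; rewrite perm1.
Qed.

Lemma bs_probE R w :
  bs_prob F R w = (wt R 1 w).[#|F|%:R] / (#|F|%:R + 1) ^+ size R.
Proof.
rewrite /bs_prob -(card_chains_wt R 1 w (borel1 F n)) flag_act1; congr (_%:R / _).
apply: eq_card => Fs; rewrite !inE -std_flagE.
apply/andP/and3P => [[/and3P[/forallP flF -> /forallP adjF] cw]|[/eqP F0 /forallP H cw]].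
  split=> //; apply/forallP=> r; rewrite /bs_step flF /=.
  by apply/adjacentP => k ki; apply/eqP; apply: (implyP (forallP (adjF r) k)).
split=> //; apply/and3P; split; last 1 first.
- apply/forallP=> r; apply/forallP=> k; apply/implyP=> ki.
  by have /andP[_ /adjacentP->] := H r.
- apply/forallP=> r; case: (unliftP ord0 r) => [r'|] ->; first by case/andP: (H r').
  by rewrite F0 std_flagE perm_flag_flag.
- exact/eqP.
Qed.

End Count.

Theorem theorem1p2 (n : nat) (hn : (1 <= n)%N) (R1 R2 : word n)
    (hR1 : reduced R1) (hR2 : reduced R2) :
  (forall (F : finFieldType) (w : {perm 'I_n}),
      bs_prob F R1 w = bs_prob F R2 w) <->
  same_commutation_class R1 R2.
Proof.
split=> [H|cls F w]; last first.
  by have [E sz] := wt_same_class w 1%g cls; rewrite !bs_probE E sz.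
(* Prime fields already supply enough values of q to determine the polynomials. *)
apply: wt_determines => // w; apply: poly_eq_primes => p prp.
have := H 'F_p w; rewrite !bs_probE card_Fp //.
have nz m : ((p%:R + 1 : rat) ^+ m != 0)%R by rewrite expf_neq0 // natr1 pnatr_eq0.
by rewrite !hornerE => /eqP; rewrite eqr_div // => /eqP.
Qed.
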